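(* Let $H$ be a finite dimensional Hopf algebra over $\mathbf{C}$ with a positive basis $B$. Then the elements of $B$ can be rescaled by some positive numbers so that (after rescaling) the pair $(H,B)$ is isomorphic to $(H(G;G_+,G_-),G)$ for a unique finite group $G$ and a unique factorization $G=G_+G_-$; that is, there is an isomorphism of Hopf algebras $H\to H(G;G_+,G_-)$ carrying the rescaled basis bijectively onto the basis $\{\{g\}:g\in G\}$, and the group $G$ together with its factorization $G=G_+G_-$ is unique up to isomorphism.
   Context: A basis $B$ of a Hopf algebra $H$ over $\mathbf{C}$ (with unit $1$, comultiplication $\Delta$, counit $\epsilon$, antipode $S$) is called positive if: (1) the coordinates of $1$ with respect to $B$ are non-negative real numbers; (2) $\epsilon(b)\ge 0$ for all $b\in B$; (3) for all $b_1,b_2\in B$ the coordinates of $b_1b_2$ are non-negative; (4) for all $b\in B$ the coordinates of $\Delta(b)$ with respect to $B\otimes B$ are non-negative; (5) for all $b\in B$ the coordinates of $S(b)$ are non-negative. A factorization $G=G_+G_-$ of a group $G$ means that $G_\pm$ are subgroups of $G$ such that every $g\in G$ can be written as $g=g_+g_-$ for unique $g_+\in G_+$, $g_-\in G_-$. Taking inverses, every $g\in G$ can also be written as $g=\bar g_-\bar g_+$ for unique $\bar g_+\in G_+$, $\bar g_-\in G_-$. The notation $g_+,g_-,\bar g_+,\bar g_-$ always refers to these elements. For a finite group $G$ with factorization $G=G_+G_-$, $H(G;G_+,G_-)$ is the Hopf algebra over $\mathbf{C}$ with basis $\{\{g\}:g\in G\}$ (identified with $G$) and operations $$\{g\}\{h\}=\begin{cases}\{\bar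 g_-h\}=\{gh_-\} & \text{if } \bar g_+=h_+,\\ 0 & \text{if } \bar g_+\ne h_+,\end{cases}\qquad \Delta\{g\}=\sum_{h,k\in G:\ h_+k=g,\ \bar k_-=h_-}\{h\}\otimes\{k\},$$ $$1=\sum_{g_+\in G_+}\{g_+\},\qquad \epsilon\{g\}=\begin{cases}1&\text{if } g_+=e,\\0&\text{if } g_+\neq e,\end{cases}\qquad S\{g\}=\{g^{-1}\}.$$ An isomorphism of factorized groups $(G;G_+,G_-)\to(G';G'_+,G'_-)$ is a group isomorphism $G\to G'$ carrying $G_+$ onto $G'_+$ and $G_-$ onto $G'_-$. *)

(* Defs.v *)
From HB Require Import structures.
From mathcomp Require Import all_boot all_order all_algebra all_fingroup all_field.
From mathcomp Require Export complex reals.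

Set Implicit Arguments.
Unset Strict Implicit.
Unset Printing Implicit Defensive.

Import Order.TTheory GRing.Theory Num.Theory.
Local Open Scope ring_scope.

(* The tensor product of two finite-dimensional spaces is modelled by matrices
   of coordinates with respect to the chosen bases of V and W; tens_lift and
   tens_liftE, tens_ext give its universal property.                          *)
Section Tensor.
Variable K : fieldType.
Implicit Types U V W : vectType K.

Definition tensor V W : Type := 'M[K]_(\dim {:V}, \dim {:W}).

HB.instance Definition _ V W :=
  Vector.copy (tensor V W) 'M[K]_(\dim {:V}, \dim {:W}).

Definition tens V W (v : V) (w : W) : tensor V W :=
  \matrix_(i, j) (coord (vbasis {:V}) i v * coord (vbasis {:W}) j w).

(* The linear map v ⊗ w |-> f v w; meaningful only for bilinear f *)
Definition tens_lift V W U (f : V -> W -> U) (t : tensor V W) : U :=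
  \sum_i \sum_j t i j *: f (vbasis {:V})`_i (vbasis {:W})`_j.

Fact tens_lift_linear V W U (f : V -> W -> U) : linear (tens_lift f).
Proof.
move=> a s t; rewrite /tens_lift scaler_sumr -big_split; apply: eq_bigr => i _.
rewrite scaler_sumr -big_split; apply: eq_bigr => j _.
by rewrite !mxE scalerDl scalerA.
Qed.
HB.instance Definition _ V W U (f : V -> W -> U) :=
  GRing.isLinear.Build K (tensor V W) U _ (tens_lift f) (tens_lift_linear f).

Lemma tens_liftE V W U (f : V -> W -> U) v w :
    (forall w, linear (f^~ w)) -> (forall v, linear (f v)) ->
  tens_lift f (tens v w) = f v w.
Proof.
move=> fl fr; rewrite /tens_lift.
pose L w := HB.pack_for {linear V -> U} (f^~ w) (GRing.isLinear.Build K V U _ (f^~ w) (fl w)).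
pose R v := HB.pack_for {linear W -> U} (f v) (GRing.isLinear.Build K W U _ (f v) (fr v)).
rewrite {2}(coord_vbasis (memvf v)) -[RHS]/(L w _) linear_sum.
apply: eq_bigr => i _; rewrite linearZ /= {2}(coord_vbasis (memvf w)).
rewrite -[f _ _]/(R _ _) linear_sum scaler_sumr.
by apply: eq_bigr => j _; rewrite linearZ /= mxE scalerA.
Qed.

Lemma tens_linl V W (w : W) : linear (@tens V W ^~ w).
Proof.
by move=> a u v; apply/matrixP => i j; rewrite !mxE linearP mulrDl mulrA.
Qed.

Lemma tens_linr V W (v : V) : linear (@tens V W v).
Proof.
by move=> a u w; apply/matrixP => i j; rewrite !mxE linearP mulrDr mulrCA.
Qed.

Lemma tens_span V W (t : tensor V W) :
  t = \sum_i \sum_j t i j *: tens (vbasis {:V})`_i (vbasis {:W})`_j.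
Proof.
have fV := basis_free (vbasisP {:V}); have fW := basis_free (vbasisP {:W}).
apply/matrixP => i j; rewrite summxE (bigD1 i) //= summxE (bigD1 j) //= !mxE.
rewrite !coord_free // !eqxx !mulr1 !big1 ?addr0 // => [i' nei | j' nej].
  rewrite summxE big1 // => j' _.
  by rewrite !mxE !coord_free // (negPf nei) mul0r mulr0.
by rewrite !mxE !coord_free // (negPf nej) !mulr0.
Qed.

Lemma tens_ext V W U (f g : {linear tensor V W -> U}) :
  (forall v w, f (tens v w) = g (tens v w)) -> f =1 g.
Proof.
move=> fg t; rewrite (tens_span t) !linear_sum; apply: eq_bigr => i _.
by rewrite !linear_sum; apply: eq_bigr => j _; rewrite !linearZ /= fg.
Qed.

Lemma tens_lift_linf V W U (f f1 f2 : V -> W -> U) a t :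
    (forall v w, f v w = a *: f1 v w + f2 v w) ->
  tens_lift f t = a *: tens_lift f1 t + tens_lift f2 t.
Proof.
move=> e; rewrite /tens_lift scaler_sumr -big_split; apply: eq_bigr => i _ /=.
rewrite scaler_sumr -big_split; apply: eq_bigr => j _ /=.
by rewrite e scalerDr !scalerA mulrC.
Qed.

(* f ⊗ g *)
Definition tens_map V W V' W' (f : V -> V') (g : W -> W') :
    tensor V W -> tensor V' W' :=
  tens_lift (fun v w => tens (f v) (g w)).
HB.instance Definition _ V W V' W' (f : V -> V') (g : W -> W') :=
  GRing.isLinear.Build K (tensor V W) (tensor V' W') _ (tens_map f g)
    (@tens_lift_linear V W _ _).

Lemma tens_mapE V W V' W' (f : V -> V') (g : W -> W') v w :
  linear f -> linear g -> tens_map f g (tens v w) = tens (f v) (g w).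
Proof.
move=> fl gl; rewrite /tens_map tens_liftE // => [w' | v'] a x y /=.
  by rewrite fl tens_linl.
by rewrite gl tens_linr.
Qed.

Definition tens_assoc U V W :
    tensor (tensor U V) W -> tensor U (tensor V W) :=
  tens_lift (fun t w => tens_lift (fun u v => tens u (tens v w)) t).
HB.instance Definition _ U V W :=
  GRing.isLinear.Build K (tensor (tensor U V) W) (tensor U (tensor V W)) _
    (@tens_assoc U V W) (@tens_lift_linear _ _ _ _).

Lemma tens_assocE U V W (u : U) (v : V) (w : W) :
  tens_assoc (tens (tens u v) w) = tens u (tens v w).
Proof.
rewrite /tens_assoc tens_liftE => [|w'|t] /=.
- rewrite tens_liftE // => [v'|u'] a x y; first by rewrite tens_linl.
  by rewrite tens_linl tens_linr.
- by move=> a x y; rewrite linearP.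
by move=> a x y; apply: tens_lift_linf => u' v'; rewrite !tens_linr.
Qed.

(* The product of A ⊗ B: (a ⊗ b)(c ⊗ d) = ac ⊗ bd *)
Definition tens_mul (A B : falgType K) (s t : tensor A B) : tensor A B :=
  tens_lift (fun a b => tens_lift (fun c d => tens (a * c) (b * d)) t) s.

Section TensMul.
Variables A B : falgType K.
Implicit Types s t : tensor A B.

Lemma tens_mul_linl t : linear (@tens_mul A B ^~ t).
Proof. exact: tens_lift_linear. Qed.

Lemma tens_mul_linr s : linear (@tens_mul A B s).
Proof. by move=> a x y; apply: tens_lift_linf => u v; rewrite linearP. Qed.

Lemma tens_mulE (a c : A) (b d : B) :
  tens_mul (tens a b) (tens c d) = tens (a * c) (b * d).
Proof.
rewrite /tens_mul tens_liftE => [|b'|a'] /=.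
- rewrite tens_liftE // => [d'|c'] x y z.
    by rewrite mulrDr -scalerAr tens_linl.
  by rewrite mulrDr -scalerAr tens_linr.
- move=> x y z; apply: tens_lift_linf => u v.
  by rewrite mulrDl -scalerAl tens_linl.
move=> x y z; apply: tens_lift_linf => u v.
by rewrite mulrDl -scalerAl tens_linr.
Qed.

Lemma tens_mul_suml (I : finType) (P : pred I) (F : I -> tensor A B) t :
  tens_mul (\sum_(i | P i) F i) t = \sum_(i | P i) tens_mul (F i) t.
Proof.
pose M := HB.pack_for {linear tensor A B -> tensor A B} (@tens_mul A B ^~ t)
  (GRing.isLinear.Build K _ _ _ (@tens_mul A B ^~ t) (tens_mul_linl t)).
exact: (linear_sum M).
Qed.

Lemma tens_mul_sumr (I : finType) (P : pred I) (F : I -> tensor A B) s :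
  tens_mul s (\sum_(i | P i) F i) = \sum_(i | P i) tens_mul s (F i).
Proof.
pose M := HB.pack_for {linear tensor A B -> tensor A B} (@tens_mul A B s)
  (GRing.isLinear.Build K _ _ _ (@tens_mul A B s) (tens_mul_linr s)).
exact: (linear_sum M).
Qed.

End TensMul.

Section TensSum.
Variables (V W : vectType K) (I : finType) (P : pred I).

Lemma tens_suml (F : I -> V) (w : W) :
  tens (\sum_(i | P i) F i) w = \sum_(i | P i) tens (F i) w.
Proof.
pose M := HB.pack_for {linear V -> tensor V W} (@tens V W ^~ w)
  (GRing.isLinear.Build K _ _ _ (@tens V W ^~ w) (tens_linl w)).
exact: (linear_sum M).
Qed.

Lemma tens_sumr (v : V) (F : I -> W) :
  tens v (\sum_(i | P i) F i) = \sum_(i | P i) tens v (F i).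
Proof.
pose M := HB.pack_for {linear W -> tensor V W} (@tens V W v)
  (GRing.isLinear.Build K _ _ _ (@tens V W v) (tens_linr v)).
exact: (linear_sum M).
Qed.

Lemma tens_lift_sum U (f : V -> W -> U) (F : I -> tensor V W) :
  tens_lift f (\sum_(i | P i) F i) = \sum_(i | P i) tens_lift f (F i).
Proof. exact: linear_sum. Qed.

Lemma tens_map_sum V' W' (f : V -> V') (g : W -> W') (F : I -> tensor V W) :
  tens_map f g (\sum_(i | P i) F i) = \sum_(i | P i) tens_map f g (F i).
Proof. exact: linear_sum. Qed.

Lemma tens_assoc_sum U (F : I -> tensor (tensor V W) U) :
  tens_assoc (\sum_(i | P i) F i) = \sum_(i | P i) tens_assoc (F i).
Proof. exact: linear_sum. Qed.

Lemma tens0l (w : W) : tens (0 : V) w = 0.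
Proof. by have := tens_linl w (-1) (0 : V) 0; rewrite scaler0 addr0 scaleN1r addNr. Qed.

Lemma tens0r (v : V) : tens v (0 : W) = 0.
Proof. by have := tens_linr v (-1) (0 : W) 0; rewrite scaler0 addr0 scaleN1r addNr. Qed.

End TensSum.

End Tensor.

HB.mixin Record isHopfAlgebra (K : fieldType) H of Falgebra K H := {
  comul : H -> tensor H H;
  counit : H -> K;
  antipode : H -> H;
  comul_linear : linear comul;
  counit_linear : scalar counit;
  antipode_linear : linear antipode;
  comulA : forall x : H,
    tens_assoc (tens_map comul id (comul x)) = tens_map id comul (comul x);
  comul_counitl : forall x : H,
    tens_lift (fun a b => counit a *: b) (comul x) = x;
  comul_counitr : forall x : H,
    tens_lift (fun a b => counit b *: a) (comul x) = x;
  comulM : forall x y : H, comul (x * y) = tens_mul (comul x) (comul y);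
  comul1 : comul 1 = tens (1 : H) (1 : H);
  counitM : forall x y : H, counit (x * y) = counit x * counit y;
  counit1 : counit 1 = 1;
  antipodel : forall x : H,
    tens_lift (fun a b => antipode a * b) (comul x) = counit x *: 1;
  antipoder : forall x : H,
    tens_lift (fun a b => a * antipode b) (comul x) = counit x *: 1;
}.

#[short(type="hopfAlgType")]
HB.structure Definition HopfAlgebra (K : fieldType) :=
  { H of isHopfAlgebra K H & Falgebra K H }.

HB.instance Definition _ K (H : hopfAlgType K) :=
  GRing.isLinear.Build K H (tensor H H) _ (@comul K H) comul_linear.
HB.instance Definition _ K (H : hopfAlgType K) :=
  GRing.isLinear.Build K H K _ (@counit K H) counit_linear.
HB.instance Definition _ K (H : hopfAlgType K) :=
  GRing.isLinear.Build K H H _ (@antipode K H) antipode_linear.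

Definition hopf_iso (K : fieldType) (H H' : hopfAlgType K)
    (f : {lrmorphism H -> H'}) : Prop :=
  [/\ bijective f,
      forall x, comul (f x) = tens_map f f (comul x),
      forall x, counit (f x) = counit x &
      forall x, antipode (f x) = f (antipode x)].

Section PositiveBasis.
Variables (K : numFieldType).

(* Over the complex numbers 0 <= z means that z is a non-negative real. *)
Definition nneg_coords (V : vectType K) n (X : n.-tuple V) (v : V) : Prop :=
  forall i, 0 <= coord X i v.

Definition tens_tuple (V : vectType K) n (B : n.-tuple V) :
    (n * n).-tuple (tensor V V) :=
  [tuple of allpairs (@tens K V V) B B].

Lemma tens_tuple_basis (V : vectType K) n (B : n.-tuple V) :
  basis_of {:V} B -> basis_of {:tensor V V} (tens_tuple B).
Proof.
move=> bB; have dimV : (\dim {:V} = n)%N by rewrite (size_basis bB).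
rewrite basisEdim size_tuple dimvf /= /dim /= !dimV leqnn andbT.
apply/subvP => t _; rewrite (tens_span t).
apply: memv_suml => i _; apply: memv_suml => j _; apply: memvZ.
pose L w := HB.pack_for {linear V -> tensor V V} (@tens K V V ^~ w)
  (GRing.isLinear.Build K V _ _ (@tens K V V ^~ w) (tens_linl w)).
pose R v := HB.pack_for {linear V -> tensor V V} (@tens K V V v)
  (GRing.isLinear.Build K V _ _ (@tens K V V v) (tens_linr v)).
rewrite (coord_basis bB (memvf (vbasis {:V})`_i)) -[tens _ _]/(L _ _) linear_sum.
apply: memv_suml => k _; rewrite linearZ /=; apply: memvZ.
rewrite (coord_basis bB (memvf (vbasis {:V})`_j)) -[tens _ _]/(R _ _) linear_sum.
apply: memv_suml => l _; rewrite linearZ /=; apply: memvZ; apply: memv_span.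
by apply/allpairsP; exists (B`_k, B`_l); rewrite !mem_nth ?size_tuple.
Qed.

Definition positive_basis (H : hopfAlgType K) n (B : n.-tuple H) : Prop :=
  basis_of {:H} B /\
  [/\ nneg_coords B 1,
      forall b, b \in B -> 0 <= counit b,
      forall b1 b2, b1 \in B -> b2 \in B -> nneg_coords B (b1 * b2),
      forall b, b \in B -> nneg_coords (tens_tuple B) (comul b) &
      forall b, b \in B -> nneg_coords B (antipode b)].

End PositiveBasis.

Structure factoredGroup := FactoredGroup {
  fgroup :> finGroupType;
  Gplus : {group fgroup};
  Gminus : {group fgroup};
  factorizationP : forall g : fgroup, exists! p : fgroup * fgroup,
    [/\ p.1 \in Gplus, p.2 \in Gminus & g = (p.1 * p.2)%g]
}.

(* g = plus g * minus g = bminus g * bplus g *)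
Section Factors.
Variable G : factoredGroup.
Implicit Types g h : G.

Definition plus g := divgr (Gplus G) (Gminus G) g.
Definition minus g := remgr (Gplus G) (Gminus G) g.
Definition bminus g := divgr (Gminus G) (Gplus G) g.
Definition bplus g := remgr (Gminus G) (Gplus G) g.

Lemma mulGpm : (Gplus G * Gminus G)%g = [set: G].
Proof.
apply/setP => g; rewrite inE; have [[a b] [[/= ap bm ->] _]] := factorizationP g.
exact: mem_mulg.
Qed.

Lemma mulGmp : (Gminus G * Gplus G)%g = [set: G].
Proof. by rewrite -[LHS]invgK invMg !invGid mulGpm -[RHS]invGid. Qed.

Lemma tiGpm : (Gplus G :&: Gminus G)%g = 1%g.
Proof.
apply/trivgP/subsetP => x /setIP[xp xm]; rewrite inE; apply/eqP.
have [p [_ u]] := factorizationP x.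
have e1 := u (x, 1%g) _; have e2 := u (1%g, x) _.
suff: (x, 1%g) = (1%g, x) by case.
by rewrite -e1 ?e2 //= ?mulg1 ?mul1g; split.
Qed.

Lemma tiGmp : (Gminus G :&: Gplus G)%g = 1%g.
Proof. by rewrite setIC tiGpm. Qed.

Lemma plusP g : plus g \in Gplus G.
Proof. by apply: mem_divgr; rewrite mulGpm inE. Qed.
Lemma minusP g : minus g \in Gminus G.
Proof. by apply: mem_remgr; rewrite mulGpm inE. Qed.
Lemma bminusP g : bminus g \in Gminus G.
Proof. by apply: mem_divgr; rewrite mulGmp inE. Qed.
Lemma bplusP g : bplus g \in Gplus G.
Proof. by apply: mem_remgr; rewrite mulGmp inE. Qed.

Lemma plus_minus g : (plus g * minus g)%g = g.
Proof. by rewrite -divgr_eq. Qed.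
Lemma bminus_bplus g : (bminus g * bplus g)%g = g.
Proof. by rewrite -divgr_eq. Qed.

End Factors.

Section FactorsTheory.
Variable G : factoredGroup.
Implicit Types g h s t : G.
Local Open Scope group_scope.

Lemma plusMl s g : s \in Gplus G -> plus (s * g) = s * plus g.
Proof. exact: divgrMl. Qed.
Lemma minusMl s g : s \in Gplus G -> minus (s * g) = minus g.
Proof. exact: remgrMl. Qed.
Lemma bminusMl x g : x \in Gminus G -> bminus (x * g) = x * bminus g.
Proof. exact: divgrMl. Qed.
Lemma bplusMl x g : x \in Gminus G -> bplus (x * g) = bplus g.
Proof. exact: remgrMl. Qed.

Lemma plus_id s : s \in Gplus G -> plus s = s.
Proof. exact: divgr_id. Qed.
Lemma minus1 s : s \in Gplus G -> minus s = 1.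
Proof. exact: remgr1. Qed.
Lemma bplus_id s : s \in Gplus G -> bplus s = s.
Proof. by apply: remgr_id; exact: tiGmp. Qed.
Lemma bminus1 s : s \in Gplus G -> bminus s = 1.
Proof. by move=> sp; rewrite /bminus /divgr -/(bplus s) bplus_id // mulgV. Qed.
Lemma minus_id x : x \in Gminus G -> minus x = x.
Proof. by apply: remgr_id; exact: tiGpm. Qed.
Lemma plus1 x : x \in Gminus G -> plus x = 1.
Proof. by move=> xm; rewrite /plus /divgr -/(minus x) minus_id // mulgV. Qed.
Lemma bminus_id x : x \in Gminus G -> bminus x = x.
Proof. exact: divgr_id. Qed.
Lemma bplus1 x : x \in Gminus G -> bplus x = 1.
Proof. exact: remgr1. Qed.

Lemma plusMr g x : x \in Gminus G -> plus (g * x) = plus g.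
Proof.
move=> xm; rewrite -{1}(plus_minus g) -mulgA plusMl ?plusP //.
by rewrite (@plus1 (_ * _)) ?mulg1 // groupM ?minusP.
Qed.
Lemma minusMr g x : x \in Gminus G -> minus (g * x) = minus g * x.
Proof.
move=> xm; rewrite -{1}(plus_minus g) -mulgA minusMl ?plusP //.
by rewrite (@minus_id (_ * _)) // groupM ?minusP.
Qed.
Lemma bminusMr g s : s \in Gplus G -> bminus (g * s) = bminus g.
Proof.
move=> sp; rewrite -{1}(bminus_bplus g) -mulgA bminusMl ?bminusP //.
by rewrite (@bminus1 (_ * _)) ?mulg1 // groupM ?bplusP.
Qed.
Lemma bplusMr g s : s \in Gplus G -> bplus (g * s) = bplus g * s.
Proof.
move=> sp; rewrite -{1}(bminus_bplus g) -mulgA bplusMl ?bminusP //.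
by rewrite (@bplus_id (_ * _)) // groupM ?bplusP.
Qed.
Lemma plusV g : plus g^-1 = (bplus g)^-1.
Proof.
by rewrite -{1}(bminus_bplus g) invMg plusMr ?groupV ?bminusP // plus_id ?groupV ?bplusP.
Qed.
Lemma minusV g : minus g^-1 = (bminus g)^-1.
Proof.
by rewrite -{1}(bminus_bplus g) invMg minusMl ?groupV ?bplusP // minus_id ?groupV ?bminusP.
Qed.
Lemma bplusV g : bplus g^-1 = (plus g)^-1.
Proof. by rewrite -[g in RHS]invgK plusV invgK. Qed.
Lemma bminusE g : bminus g = g * (bplus g)^-1. Proof. by []. Qed.
Lemma minusE g : minus g = (plus g)^-1 * g.
Proof. by rewrite -{3}(plus_minus g) mulKg. Qed.
Lemma mul_bminusE g h : bplus g = plus h -> bminus g * h = g * minus h.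
Proof.
by move=> e; rewrite -{1}(plus_minus h) -e mulgA bminus_bplus.
Qed.

End FactorsTheory.

(* The Hopf algebra H(G; G+, G-): hG K G is the space with basis
   {g} = hbase K g, and its structure maps are the linear extensions of their
   values on that basis.                                                      *)
Definition hG (K : fieldType) (G : factoredGroup) : Type := {ffun G -> K^o}.

Section HG.
Variables (K : fieldType) (G : factoredGroup).

HB.instance Definition _ := Vector.copy (hG K G) {ffun G -> K^o}.

Definition hbase (g : G) : hG K G := [ffun h => (h == g)%:R].

Definition hext (V : lmodType K) (f : G -> V) (x : hG K G) : V :=
  \sum_g x g *: f g.

Fact hext_linear (V : lmodType K) (f : G -> V) : linear (hext f).
Proof.
move=> a x y; rewrite /hext scaler_sumr -big_split; apply: eq_bigr => g _.
by rewrite !ffunE scalerDl scalerA.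
Qed.
HB.instance Definition _ (V : lmodType K) (f : G -> V) :=
  GRing.isLinear.Build K (hG K G) V _ (hext f) (hext_linear f).

Lemma hextE (V : lmodType K) (f : G -> V) g : hext f (hbase g) = f g.
Proof.
rewrite /hext (bigD1 g) //= ffunE eqxx scale1r big1 ?addr0 // => h /negPf hg.
by rewrite ffunE hg scale0r.
Qed.

Lemma hbase_span (x : hG K G) : x = \sum_g x g *: hbase g.
Proof.
apply/ffunP => h; rewrite sum_ffunE (bigD1 h) //= !ffunE eqxx.
rewrite [_ *: _]mulr1 big1 ?addr0 // => g /negPf gh.
by rewrite !ffunE eq_sym gh [_ *: _]mulr0.
Qed.

Lemma hG_ext (V : lmodType K) (f f' : hG K G -> V) :
  linear f -> linear f' -> (forall g, f (hbase g) = f' (hbase g)) -> f =1 f'.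
Proof.
move=> fl f'l e x; rewrite (hbase_span x).
pose F := HB.pack_for {linear hG K G -> V} f (GRing.isLinear.Build K _ _ _ f fl).
pose F' := HB.pack_for {linear hG K G -> V} f' (GRing.isLinear.Build K _ _ _ f' f'l).
rewrite -[LHS]/(F _) -[RHS]/(F' _) !linear_sum; apply: eq_bigr => g _.
by rewrite !linearZ /= e.
Qed.

Definition hmul (x y : hG K G) : hG K G :=
  hext (fun g => hext (fun h =>
    if bplus g == plus h then hbase (bminus g * h)%g else 0) y) x.

Definition hone : hG K G := \sum_(g in Gplus G) hbase g.

Definition hcomul : hG K G -> tensor (hG K G) (hG K G) :=
  hext (fun g =>
    \sum_h \sum_(k | ((plus h * k)%g == g) && (bminus k == minus h))
      tens (hbase h) (hbase k)).

Definition hcounit (x : hG K G) : K :=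
  hext (fun g => (plus g == 1%g)%:R : K^o) x.

Definition hantipode : hG K G -> hG K G := hext (fun g => hbase g^-1%g).

Lemma hmul_linl y : linear (hmul^~ y).
Proof. by move=> a x x'; rewrite /hmul linearP. Qed.

Lemma hmul_linr x : linear (hmul x).
Proof.
move=> a y y'; pose F g := hext (fun h =>
  if bplus g == plus h then hbase (bminus g * h)%g else 0).
rewrite -[hmul x _]/(\sum_g x g *: F g (a *: y + y')).
rewrite -[hmul x y]/(\sum_g x g *: F g y) -[hmul x y']/(\sum_g x g *: F g y').
rewrite scaler_sumr -big_split; apply: eq_bigr => g _ /=.
by rewrite /F linearP scalerDr !scalerA [a * _]mulrC.
Qed.

Lemma hmulE g h : hmul (hbase g) (hbase h) =
  if bplus g == plus h then hbase (g * minus h)%g else 0.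
Proof. by rewrite /hmul !hextE; case: eqP => // /mul_bminusE ->. Qed.

Fact hmulA : associative hmul.
Proof.
move=> x y z; move: x; apply: hG_ext.
- exact: hmul_linl.
- by move=> a x x'; rewrite !hmul_linl.
move=> g; move: y; apply: hG_ext.
- by move=> a x x'; rewrite hmul_linl hmul_linr.
- by move=> a x x'; rewrite hmul_linr hmul_linl.
move=> h; move: z; apply: hG_ext.
- by move=> a x x'; rewrite !hmul_linr.
- by move=> a x x'; rewrite !hmul_linr.
move=> k; rewrite !hmulE.
have e0l x : hmul x 0 = 0 by have := hmul_linr x (-1) 0 0; rewrite scaler0 addr0 scaleN1r addNr.
have e0r x : hmul 0 x = 0 by have := hmul_linl x (-1) 0 0; rewrite scaler0 addr0 scaleN1r addNr.
have [hk | nhk] := eqVneq (bplus h) (plus k); last first.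
  rewrite e0l; have [gh | _] := eqVneq; last by rewrite e0r.
  by rewrite hmulE -mul_bminusE // bplusMl ?bminusP // (negPf nhk).
rewrite hmulE plusMr ?minusP //; have [gh | _] := eqVneq; last by rewrite e0r.
rewrite hmulE -(mul_bminusE gh) bplusMl ?bminusP // hk eqxx (mul_bminusE gh).
by rewrite minusMr ?minusP // mulgA.
Qed.

Fact hmul1l : left_id hone hmul.
Proof.
move=> x; move: x; apply: hG_ext => [a x x' | a x x' | g]; rewrite ?hmul_linr //.
pose M := HB.pack_for {linear hG K G -> hG K G} (hmul^~ (hbase g))
  (GRing.isLinear.Build K _ _ _ (hmul^~ (hbase g)) (hmul_linl (hbase g))).
rewrite -[LHS]/(M hone) linear_sum (bigD1 (plus g)) ?plusP //= hmulE.
rewrite bplus_id ?plusP // eqxx plus_minus big1 ?addr0 // => h /andP[hp /negPf nh].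
by rewrite hmulE bplus_id // nh.
Qed.

Fact hmul1r : right_id hone hmul.
Proof.
move=> x; move: x; apply: hG_ext => [a x x' | a x x' | g]; rewrite ?hmul_linl //.
pose M := HB.pack_for {linear hG K G -> hG K G} (hmul (hbase g))
  (GRing.isLinear.Build K _ _ _ (hmul (hbase g)) (hmul_linr (hbase g))).
rewrite -[LHS]/(M hone) linear_sum (bigD1 (bplus g)) ?bplusP //= hmulE.
rewrite plus_id ?bplusP // eqxx minus1 ?bplusP // mulg1.
rewrite big1 ?addr0 // => h /andP[hp /negPf nh].
by rewrite hmulE plus_id // eq_sym nh.
Qed.

Fact hmulDl : left_distributive hmul +%R.
Proof. by move=> x y z; have := hmul_linl z 1 x y; rewrite !scale1r. Qed.
Fact hmulDr : right_distributive hmul +%R.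
Proof. by move=> x y z; have := hmul_linr x 1 y z; rewrite !scale1r. Qed.

Fact hone_neq0 : hone != 0.
Proof.
apply/eqP => /ffunP/(_ 1%g); rewrite sum_ffunE (bigD1 1%g) ?group1 //= !ffunE eqxx.
rewrite big1 ?addr0 => [/eqP | h /andP[_ /negPf nh]]; first by rewrite oner_eq0.
by rewrite ffunE eq_sym nh.
Qed.

HB.instance Definition _ := GRing.Zmodule_isNzRing.Build (hG K G)
  hmulA hmul1l hmul1r hmulDl hmulDr hone_neq0.

Fact hscaleAl (a : K) (x y : hG K G) : a *: (x * y) = (a *: x) * y.
Proof. by have := hmul_linl y a x 0; rewrite addr0 -[hmul 0 y]/((0 : hG K G) * y) mul0r addr0. Qed.
HB.instance Definition _ := GRing.Lmodule_isLalgebra.Build K (hG K G) hscaleAl.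

Fact hscaleAr (a : K) (x y : hG K G) : a *: (x * y) = x * (a *: y).
Proof. by have := hmul_linr x a y 0; rewrite addr0 -[hmul x 0]/(x * (0 : hG K G)) mulr0 addr0. Qed.
HB.instance Definition _ := GRing.Lalgebra_isAlgebra.Build K (hG K G) hscaleAr.
HB.instance Definition _ := Algebra_isFalgebra.Build K (hG K G).

Lemma hbaseM g h : hbase g * hbase h =
  if bplus g == plus h then hbase (g * minus h)%g else 0.
Proof. exact: hmulE. Qed.

Fact hcomul_linear : linear hcomul. Proof. exact: hext_linear. Qed.
Fact hcounit_linear : scalar hcounit.
Proof. by move=> a x y; rewrite /hcounit linearP. Qed.
Fact hantipode_linear : linear hantipode. Proof. exact: hext_linear. Qed.

Definition lfac (g s : G) : G := (s * bminus (s^-1 * g))%g.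

Lemma plus_lfac g s : s \in Gplus G -> plus (lfac g s) = s.
Proof. by move=> sp; rewrite plusMr ?bminusP // plus_id. Qed.

Lemma minus_lfac g s : s \in Gplus G -> minus (lfac g s) = bminus (s^-1 * g)%g.
Proof. by move=> sp; rewrite minusMl // minus_id ?bminusP. Qed.

Lemma lfacE g s : lfac g s = (g * (bplus (s^-1 * g))^-1)%g.
Proof. by rewrite /lfac bminusE !mulgA mulgV mul1g. Qed.

Lemma bplus_lfac g s : bplus (lfac g s) = (bplus g * (bplus (s^-1 * g))^-1)%g.
Proof. by rewrite lfacE bplusMr ?groupV ?bplusP. Qed.

Lemma hcomulE g : hcomul (hbase g) =
  \sum_(s in Gplus G) tens (hbase (lfac g s)) (hbase (s^-1 * g)%g).
Proof.
rewrite /hcomul hextE; pose F h k := tens (hbase h) (hbase k).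
pose P h := bminus ((plus h)^-1 * g)%g == minus h.
transitivity (\sum_(h | P h) F h ((plus h)^-1 * g)%g).
  rewrite [RHS]big_mkcond; apply: eq_bigr => h _; rewrite /P.
  have [e | ne] := eqVneq (bminus _) (minus h).
    rewrite (big_pred1 ((plus h)^-1 * g)%g) // => k /=.
    apply/andP/eqP => [[/eqP <- _] | ->]; first by rewrite mulKg.
    by rewrite mulKVg e !eqxx.
  rewrite big1 // => k /andP[/eqP gE /eqP kE]; case/eqP: ne.
  by rewrite -gE mulKg.
rewrite (reindex_onto (lfac g) (@plus G)) => [| h /eqP e]; last first.
  by rewrite /lfac e plus_minus.
apply: eq_big => [s | s /andP[_ /eqP ->] //].
apply/andP/idP => [[_ /eqP <-] | sp]; first exact: plusP.
by rewrite /P plus_lfac // minus_lfac // !eqxx.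
Qed.

Lemma hcounitE g : hcounit (hbase g) = (plus g == 1%g)%:R.
Proof. by rewrite /hcounit hextE. Qed.

Lemma hantipodeE g : hantipode (hbase g) = hbase g^-1%g.
Proof. by rewrite /hantipode hextE. Qed.

HB.instance Definition _ := GRing.isLinear.Build K (hG K G)
  (tensor (hG K G) (hG K G)) _ hcomul hcomul_linear.
HB.instance Definition _ := GRing.isLinear.Build K (hG K G) K _ hcounit
  hcounit_linear.
HB.instance Definition _ := GRing.isLinear.Build K (hG K G) (hG K G) _
  hantipode hantipode_linear.

Lemma reindexGp (V : nmodType) (r : G) (F : G -> V) : r \in Gplus G ->
  \sum_(s in Gplus G) F s = \sum_(s in Gplus G) F (r * s)%g.
Proof.
move=> rp; rewrite (reindex_inj (mulgI r)).
by apply: eq_bigl => s; rewrite groupMl.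
Qed.

Fact hcomulA (x : hG K G) :
  tens_assoc (tens_map hcomul id (hcomul x)) = tens_map id hcomul (hcomul x).
Proof.
move: x; apply: hG_ext => [a x y | a x y | g]; rewrite ?linearP //.
have idl : linear (@id (hG K G)) by [].
rewrite hcomulE !tens_map_sum tens_assoc_sum.
under eq_bigr => s sp do
  rewrite (tens_mapE _ _ hcomul_linear idl) hcomulE tens_suml tens_assoc_sum.
under [RHS]eq_bigr => s sp do rewrite (tens_mapE _ _ idl hcomul_linear) hcomulE tens_sumr.
rewrite exchange_big; apply: eq_bigr => t tp.
rewrite (reindexGp _ tp); apply: eq_bigr => q qp; rewrite tens_assocE.
have e : (t^-1 * lfac g (t * q) = lfac (t^-1 * g) q)%g.
  by rewrite /lfac invMg !mulgA mulVg mul1g.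
rewrite e invMg mulgA; congr tens; rewrite /lfac e; congr hbase.
by rewrite lfacE bminusMr ?groupV ?bplusP.
Qed.

Fact hcounitl (x : hG K G) :
  tens_lift (fun a b => hcounit a *: b) (hcomul x) = x.
Proof.
move: x; apply: hG_ext => [a x y | a x y | g]; rewrite ?linearP //.
have E a b : tens_lift (fun a b : hG K G => hcounit a *: b) (tens a b) =
    hcounit a *: b.
  rewrite tens_liftE => // [w|v] c x y; first by rewrite linearP scalerDl scalerA.
  by rewrite scalerDr !scalerA mulrC.
rewrite hcomulE tens_lift_sum (bigD1 1%g) ?group1 //=.
rewrite E hcounitE plus_lfac ?group1 // eqxx scale1r invg1 mul1g.
rewrite big1 ?addr0 // => s /andP[sp /negPf ns].
by rewrite E hcounitE plus_lfac // ns scale0r.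
Qed.

Fact hcounitr (x : hG K G) :
  tens_lift (fun a b => hcounit b *: a) (hcomul x) = x.
Proof.
move: x; apply: hG_ext => [a x y | a x y | g]; rewrite ?linearP //.
have E a b : tens_lift (fun a b : hG K G => hcounit b *: a) (tens a b) =
    hcounit b *: a.
  rewrite tens_liftE => // [w|v] c x y; last by rewrite linearP scalerDl scalerA.
  by rewrite scalerDr !scalerA mulrC.
rewrite hcomulE tens_lift_sum (bigD1 (plus g)) ?plusP //=.
rewrite E hcounitE plusMl ?groupV ?plusP // mulVg eqxx scale1r.
rewrite /lfac -minusE bminus_id ?minusP // plus_minus.
rewrite big1 ?addr0 // => s /andP[sp ns].
by rewrite E hcounitE plusMl ?groupV // -eq_mulVg1 (negPf ns) scale0r.
Qed.

Fact hcomulM (x y : hG K G) :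
  hcomul (x * y) = tens_mul (hcomul x) (hcomul y).
Proof.
move: x; apply: hG_ext => [a x x' | a x x' | g].
- by rewrite mulrDl -scalerAl linearP.
- by rewrite linearP tens_mul_linl.
move: y; apply: hG_ext => [a x x' | a x x' | h].
- by rewrite mulrDr -scalerAr linearP.
- by rewrite linearP tens_mul_linr.
rewrite [hcomul (hbase g)]hcomulE [hcomul (hbase h)]hcomulE tens_mul_suml.
under [RHS]eq_bigr => s sp do rewrite tens_mul_sumr.
have key s t : s \in Gplus G -> t \in Gplus G ->
  tens_mul (tens (hbase (lfac g s)) (hbase (s^-1 * g)%g))
           (tens (hbase (lfac h t)) (hbase (t^-1 * h)%g)) =
  if (t == bplus (lfac g s)) && (bplus g == plus h) then
    tens (hbase (lfac (g * minus h) s)) (hbase (s^-1 * (g * minus h))%g) else 0.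
  move=> sp tp; rewrite tens_mulE !hbaseM plus_lfac // plusMl ?groupV // eq_sym.
  have [tE | _] /= := eqVneq t; last by rewrite tens0l.
  have e : (bplus (s^-1 * g) == t^-1 * plus h)%g = (bplus g == plus h).
    rewrite tE bplus_lfac invMg invgK -mulgA -[X in X == _]mulg1.
    by rewrite (inj_eq (mulgI _)) eq_sym -eq_mulVg1.
  rewrite e; have [gh | _] := eqVneq; last by rewrite tens0r.
  rewrite minus_lfac // minusMl ?groupV //.
  congr tens; last by rewrite mulgA.
  have e' : bplus (s^-1 * g)%g = plus (t^-1 * h)%g.
    by rewrite plusMl ?groupV //; apply/eqP; rewrite e gh.
  have := mul_bminusE e'; rewrite minusMl ?groupV // => e2.
  congr hbase; rewrite /lfac -(mulgA s (bminus _)); congr (s * _)%g.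
  by rewrite (mulgA _ g (minus h)) -e2 bminusMl ?bminusP.
under [RHS]eq_bigr => s sp do under eq_bigr => t tp do rewrite key //.
rewrite hbaseM; have [gh | _] := eqVneq; last first.
  rewrite linear0 big1 // => s sp; rewrite big1 // => t tp.
  by rewrite andbF.
rewrite hcomulE; apply: eq_bigr => s sp; under eq_bigr do rewrite andbT.
rewrite -big_mkcondr (big_pred1 (bplus (lfac g s))) // => t /=.
by have [-> | _] := eqVneq t; rewrite ?andbF // bplusP.
Qed.

Fact hcomul1 : hcomul 1 = tens (1 : hG K G) (1 : hG K G).
Proof.
rewrite -[1]/hone /hone tens_suml.
have -> : hcomul (\sum_(g in Gplus G) hbase g) =
  \sum_(g in Gplus G) hcomul (hbase g) by exact: linear_sum.
under eq_bigr => g gp do rewrite hcomulE.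
rewrite exchange_big; apply: eq_bigr => s sp; rewrite tens_sumr.
rewrite (reindexGp _ sp); apply: eq_bigr => t tp.
by rewrite /lfac mulKg bminus1 // mulg1.
Qed.

Fact hcounitM (x y : hG K G) : hcounit (x * y) = hcounit x * hcounit y.
Proof.
move: x; apply: (@hG_ext K^o) => [a x x' | a x x' | g].
- by rewrite mulrDl -scalerAl linearP.
- by rewrite linearP mulrDl scalerAl.
move: y; apply: (@hG_ext K^o) => [a x x' | a x x' | h].
- by rewrite mulrDr -scalerAr linearP.
- by rewrite linearP mulrDr scalerAr.
rewrite hbaseM !hcounitE -natrM mulnb; have [g1 | ng1] := eqVneq (plus g) 1%g.
  have -> : bplus g = 1%g by rewrite -(plus_minus g) g1 mul1g bplus1 ?minusP.
  rewrite eq_sym; case: eqP => h1; last by rewrite linear0.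
  by rewrite hcounitE plusMr ?minusP // g1 eqxx.
case: eqP => gh; last by rewrite linear0.
by rewrite hcounitE plusMr ?minusP // (negPf ng1).
Qed.

Fact hcounit1 : hcounit 1 = 1.
Proof.
have -> : hcounit 1 = \sum_(g in Gplus G) hcounit (hbase g).
  exact: linear_sum.
rewrite (bigD1 1%g) ?group1 //= hcounitE.
rewrite plus_id ?group1 // eqxx big1 ?addr0 // => g /andP[gp /negPf ng].
by rewrite hcounitE plus_id // ng.
Qed.

Fact hantipodel (x : hG K G) :
  tens_lift (fun a b => hantipode a * b) (hcomul x) = hcounit x *: 1.
Proof.
move: x; apply: hG_ext => [a x y | a x y | g].
- by rewrite !linearP.
- by rewrite linearP scalerDl scalerA.
have E a b : tens_lift (fun a b : hG K G => hantipode a * b) (tens a b) =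
    hantipode a * b.
  rewrite tens_liftE => // [w|v] c x y.
    by rewrite linearP mulrDl scalerAl.
  by rewrite mulrDr scalerAr.
rewrite hcomulE tens_lift_sum hcounitE.
have key s : s \in Gplus G -> tens_lift (fun a b : hG K G => hantipode a * b)
    (tens (hbase (lfac g s)) (hbase (s^-1 * g)%g)) =
  if plus g == 1%g then hbase (bplus (s^-1 * g))%g else 0.
  move=> sp; rewrite E hantipodeE hbaseM bplusV plus_lfac // plusMl ?groupV //.
  rewrite -[X in X == _]mulg1 (inj_eq (mulgI _)) eq_sym.
  case: eqP => // g1; congr hbase; rewrite minusMl ?groupV // minusE g1 invg1 mul1g.
  by rewrite lfacE invMg invgK mulgKV.
rewrite (eq_bigr _ key); case: eqP => [g1 | _]; last by rewrite big1 ?scale0r.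
rewrite scale1r -[1]/hone /hone.
rewrite [RHS](reindex_onto (fun s => bplus (s^-1 * g)%g) (fun r => plus (g * r^-1)%g)).
  apply: eq_bigl => s; apply/idP/andP => [sp | [_ /eqP <-]]; last exact: plusP.
  split; first exact: bplusP.
  by rewrite -lfacE plus_lfac.
move=> r rp; have -> : ((plus (g * r^-1))^-1 * g = minus (g * r^-1) * r)%g.
  by rewrite minusE mulgA mulgKV.
by rewrite bplusMl ?minusP // bplus_id.
Qed.

Fact hantipoder (x : hG K G) :
  tens_lift (fun a b => a * hantipode b) (hcomul x) = hcounit x *: 1.
Proof.
move: x; apply: hG_ext => [a x y | a x y | g].
- by rewrite !linearP.
- by rewrite linearP scalerDl scalerA.
have E a b : tens_lift (fun a b : hG K G => a * hantipode b) (tens a b) =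
    a * hantipode b.
  rewrite tens_liftE => // [w|v] c x y.
    by rewrite mulrDl scalerAl.
  by rewrite linearP mulrDr scalerAr.
rewrite hcomulE tens_lift_sum hcounitE -[X in _ *: X]/hone /hone scaler_sumr.
apply: eq_bigr => s sp; rewrite E hantipodeE hbaseM bplus_lfac plusV minusV.
rewrite -[X in _ == X]mul1g (inj_eq (mulIg _)).
have -> : (bplus g == 1%g) = (plus g == 1%g).
  apply/eqP/eqP => e.
    by rewrite -(bminus_bplus g) e mulg1 plus1 ?bminusP.
  by rewrite -(plus_minus g) e mul1g bplus1 ?minusP.
by case: eqP => _; rewrite ?scale0r // scale1r /lfac mulgK.
Qed.

HB.instance Definition _ := isHopfAlgebra.Build K (hG K G)
  hcomul_linear hcounit_linear hantipode_linear hcomulA hcounitl hcounitr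
  hcomulM hcomul1 hcounitM hcounit1 hantipodel hantipoder.

End HG.

Definition factored_iso (G G' : factoredGroup) : Prop :=
  exists f : {morphism [set: G] >-> G'},
    [/\ isom [set: G] [set: G'] f,
        (f @* Gplus G)%g = Gplus G' & (f @* Gminus G)%g = Gminus G'].

(* A basis rescaled by positive numbers c is carried by a Hopf isomorphism
   bijectively onto the basis {g} of H(G; G+, G-).                            *)
Definition rescales_to (K : numFieldType) (H : hopfAlgType K) n (B : n.-tuple H)
    (G : factoredGroup) : Prop :=
  exists c : 'I_n -> K, (forall i, 0 < c i) /\
  exists f : {lrmorphism H -> hG K G}, hopf_iso f /\
  exists sigma : 'I_n -> G, bijective sigma /\
  forall i, f (c i *: tnth B i) = hbase K (sigma i).

(* Main.v *)
Require Import Defs.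
From HB Require Import structures.
From mathcomp Require Import all_boot all_order all_algebra all_fingroup all_field.
From mathcomp Require Import complex reals ring.

Set Implicit Arguments.
Unset Strict Implicit.
Unset Printing Implicit Defensive.

Import Order.TTheory GRing.Theory Num.Theory.
Local Open Scope ring_scope.

(** Non-negative numbers cannot cancel.  Hence every identity between the
    structure constants of a positive basis also holds for their supports,
    read as an identity between relations on the index set I: the supports
    form a Hopf monoid in the category of finite sets and relations
    (relHopf, pos_support).  Such a structure is completely rigid, and all of
    the combinatorics of the theorem takes place there.

    The basis elements occurring in 1 are orthogonal idempotents, so each b
    has a left and a right one, and products vanish unless these match; the
    dual statement holds for the elements with non-zero counit and the
    coproduct.  In H(G; G+, G-) these four maps are the four factors of g.
    The antipode axiom, read on supports, does the rest.  Applied to an f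
    with non-zero counit it makes f invertible (counit_inv).  Applied to the
    term b ⊗ f of the coproduct of b it shows that b has non-zero counit as
    soon as its right unit is the common element 1 of the unit and the
    counit (runit1_counit), for otherwise the non-zero b f^-1 would have to
    vanish.  Applied to f once more it produces, for every unit i, a p with
    left unit i and left counit f which has an inverse in the sense of
    groupoids (coord_ex).  Multiplication by p matches the elements with
    these two coordinates with a single unit, so b is determined by its left
    unit and left counit, all these pairs occur, and every b is invertible:
    both products are groupoids on I.

    The group is I itself.  Left and right translations by units and by
    elements of non-zero counit are defined by filling squares in the two
    groupoids; the left ones commute with the right ones (lact_ract,
    lact_coact: associativity and the bialgebra axiom), and right translations
    act transitively.  So left translations form a group acting regularly on
    I, which gives the required law (mulGA), and this group is factorized by
    the units and the elements of non-zero counit.  As the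
    relations determine the product of G (represents_uniq), G is unique.

    There remain the numerical values of the structure constants.  They are a
    pair of compatible positive 2-cocycles on the two groupoids, and positive
    numbers have roots, so that geometric means over the translates of an
    element trivialize first one cocycle and then the other without spoiling
    the first (weights_exist).  After this rescaling product, coproduct,
    unit and counit are those of H(G; G+, G-); the antipode then follows,
    because it is determined by them (bialgebra_antipode). *)

(** * Hopf monoids in the category of relations *)

(** Read mulR i j k as: k occurs in the product of i and j; and comulR i j k
    as: i ⊗ j occurs in the coproduct of k.  With the coproduct written as a
    second product, the axioms are visibly self-dual. *)
Record relHopf (I : finType) := RelHopf {
  mulR : I -> I -> I -> bool;
  comulR : I -> I -> I -> bool;
  unitR : pred I;
  counitR : pred I;
  antiR : rel I;
  mulRA : forall i j k t,
    (exists s, mulR i j s /\ mulR s k t) <-> (exists s, mulR j k s /\ mulR i s t);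
  unitRl : forall j k, (exists i, unitR i /\ mulR i j k) <-> j = k;
  unitRr : forall j k, (exists i, unitR i /\ mulR j i k) <-> j = k;
  comulRA : forall i j k t,
    (exists s, comulR i j s /\ comulR s k t) <->
    (exists s, comulR j k s /\ comulR i s t);
  counitRl : forall j k, (exists i, counitR i /\ comulR i j k) <-> j = k;
  counitRr : forall j k, (exists i, counitR i /\ comulR j i k) <-> j = k;
  bialgR : forall i j k l,
    (exists s, mulR i j s /\ comulR k l s) <->
    (exists p q r t, [/\ comulR p q i, comulR r t j, mulR p r k & mulR q t l]);
  comulR_unit : forall k l,
    (exists s, unitR s /\ comulR k l s) <-> unitR k /\ unitR l;
  counitR_mul : forall i j,
    (exists s, counitR s /\ mulR i j s) <-> counitR i /\ counitR j;
  counitR_unit : exists s, unitR s /\ counitR s;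
  antiRl : forall i r,
    (exists p q p', [/\ comulR p q i, antiR p p' & mulR p' q r]) <->
    counitR i /\ unitR r;
  antiRr : forall i r,
    (exists p q q', [/\ comulR p q i, antiR q q' & mulR p q' r]) <->
    counitR i /\ unitR r
}.

(** The two symmetries below, dualR (transpose all relations) and oppR
    (reverse both products), turn each lemma into four. *)
Section Symmetry.
Variables (I : finType) (D : relHopf I).

Program Definition dualR : relHopf I := {|
  mulR := comulR D; comulR := mulR D; unitR := counitR D; counitR := unitR D;
  antiR i j := antiR D j i;
  mulRA := comulRA D; unitRl := counitRl D; unitRr := counitRr D;
  comulRA := mulRA D; counitRl := unitRl D; counitRr := unitRr D;
  comulR_unit := counitR_mul D; counitR_mul := comulR_unit D |}.
Next Obligation.
split=> [[s [ws ms]] | [p [q [r [t [mi mj wk wl]]]]]].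
  have /bialgR [p [q [r [t [a b c d]]]]] : exists s, mulR D k l s /\ comulR D i j s by exists s.
  by exists p, r, q, t; split.
have /bialgR [s [ms ws]] : exists p q r t,
    [/\ comulR D p q k, comulR D r t l, mulR D p r i & mulR D q t j].
  by exists p, r, q, t; split.
by exists s.
Qed.
Next Obligation. by have [s [us vs]] := counitR_unit D; exists s. Qed.
Next Obligation.
split=> [[p [q [p' [m s w]]]] | [ui vr]].
  suff: counitR D r /\ unitR D i by case.
  by apply/antiRl; exists p', q, p.
have /antiRl [p [q [p' [w s m]]]] : counitR D r /\ unitR D i by [].
by exists p', q, p.
Qed.
Next Obligation.
split=> [[p [q [q' [m s w]]]] | [ui vr]].
  suff: counitR D r /\ unitR D i by case.
  by apply/antiRr; exists p, q', q.
have /antiRr [p [q [q' [w s m]]]] : counitR D r /\ unitR D i by [].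
by exists p, q', q.
Qed.

Program Definition oppR : relHopf I := {|
  mulR i j := mulR D j i; comulR i j := comulR D j i;
  unitR := unitR D; counitR := counitR D; antiR := antiR D;
  unitRl := unitRr D; unitRr := unitRl D;
  counitRl := counitRr D; counitRr := counitRl D;
  counitR_unit := counitR_unit D |}.
Next Obligation. by have [h1 h2] := mulRA D k j i t; split. Qed.
Next Obligation. by have [h1 h2] := comulRA D k j i t; split. Qed.
Next Obligation.
have [h1 h2] := bialgR D j i l k; split=> [/h1 | [p [q [r [t [a b c d]]]]]].
  by move=> [p [q [r [t [a b c d]]]]]; exists t, r, q, p.
by apply: h2; exists t, r, q, p.
Qed.
Next Obligation.
by have [h1 h2] := comulR_unit D l k; split=> [/h1 [] | [? ?]] //; apply: h2.
Qed.
Next Obligation.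
by have [h1 h2] := counitR_mul D j i; split=> [/h1 [] | [? ?]] //; apply: h2.
Qed.
Next Obligation.
have [h1 h2] := antiRr D i r; split=> [[p [q [p' [a b c]]]] | /h2].
  by apply: h1; exists q, p, p'.
by move=> [q [p [p' [a b c]]]]; exists p, q, p'.
Qed.
Next Obligation.
have [h1 h2] := antiRl D i r; split=> [[p [q [p' [a b c]]]] | /h2].
  by apply: h1; exists q, p, p'.
by move=> [q [p [p' [a b c]]]]; exists p, q, p'.
Qed.

End Symmetry.

(** * Units and counits of an element *)
Section Units.
Variables (I : finType) (D : relHopf I).

(** For the structure carried by a factorized group these are the factors
    g_+, \bar g_+, \bar g_- and g_- of g, in this order.  The last two are
    the first two for dualR D, and right is left for oppR D; the four
    definitions are convertible under these symmetries. *)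
Definition lunit b := odflt b [pick i | unitR D i && mulR D i b b].
Definition runit b := odflt b [pick i | unitR D i && mulR D b i b].
Definition lcounit b := odflt b [pick i | counitR D i && comulR D i b b].
Definition rcounit b := odflt b [pick i | counitR D i && comulR D b i b].

Fact ex_one : exists i, unitR D i && counitR D i.
Proof. by have [i [ui vi]] := counitR_unit D; exists i; rewrite ui. Qed.
Definition oneR := xchoose ex_one.

Lemma one_unit : unitR D oneR.
Proof. by have /andP[] := xchooseP ex_one. Qed.
Lemma one_counit : counitR D oneR.
Proof. by have /andP[] := xchooseP ex_one. Qed.

End Units.

Section LeftUnits.
Variables (I : finType) (D : relHopf I).
Implicit Types a b e f i j k p q x y : I.

Lemma unit_mull e j k : unitR D e -> mulR D e j k -> j = k.
Proof. by move=> ue m; apply/(unitRl D); exists e. Qed.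

Lemma unit_mulr e j k : unitR D e -> mulR D j e k -> j = k.
Proof. by move=> ue m; apply/(unitRr D); exists e. Qed.

Lemma unit_mul_id e : unitR D e -> mulR D e e e.
Proof.
move=> ue; have /(unitRr D)[i [ui m]] : e = e by [].
by have ie := unit_mull ue m; rewrite ie in m.
Qed.

Lemma unit_disj e e' k : unitR D e -> unitR D e' -> mulR D e e' k -> e = e'.
Proof.
by move=> ue ue' m; rewrite (unit_mull ue m) -(unit_mulr ue' m).
Qed.

Lemma lunitP b : unitR D (lunit D b) /\ mulR D (lunit D b) b b.
Proof.
rewrite /lunit; case: pickP => [i /andP[] // | no].
have /(unitRl D)[i [ui m]] : b = b by [].
by have := no i; rewrite ui m.
Qed.

Lemma lunit_unit b : unitR D (lunit D b). Proof. by case: (lunitP b). Qed.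
Lemma mul_lunit b : mulR D (lunit D b) b b. Proof. by case: (lunitP b). Qed.

Lemma lunit_uniq e b x : unitR D e -> mulR D e b x -> lunit D b = e.
Proof.
move=> ue m; have xb := unit_mull ue m; rewrite -{x}xb in m.
have [s [m1 _]] : exists s, mulR D e (lunit D b) s /\ mulR D s b b.
  by apply/mulRA; exists b; split=> //; exact: mul_lunit.
by rewrite (unit_disj ue (lunit_unit b) m1).
Qed.

Lemma lunit_id e : unitR D e -> lunit D e = e.
Proof. by move=> ue; exact: lunit_uniq ue (unit_mul_id ue). Qed.

Lemma lunit_mul a b x : mulR D a b x -> lunit D x = lunit D a.
Proof.
move=> m; have [s [m1 m2]] :
    exists s, mulR D a b s /\ mulR D (lunit D a) s x.
  by apply/mulRA; exists a; split=> //; exact: mul_lunit.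
rewrite -(unit_mull (lunit_unit a) m2).
exact: lunit_uniq (lunit_unit a) m2.
Qed.

End LeftUnits.

Section RightUnits.
Variables (I : finType) (D : relHopf I).
Implicit Types a b e f i j k p q x y : I.

Lemma runit_unit b : unitR D (runit D b). Proof. exact: (lunit_unit (oppR D)). Qed.
Lemma mul_runit b : mulR D b (runit D b) b. Proof. exact: (mul_lunit (oppR D)). Qed.
Lemma runit_id e : unitR D e -> runit D e = e.
Proof. exact: (@lunit_id _ (oppR D)). Qed.
Lemma runit_mul a b x : mulR D a b x -> runit D x = runit D b.
Proof. exact: (@lunit_mul _ (oppR D)). Qed.

Lemma mul_composable a b x : mulR D a b x -> runit D a = lunit D b.
Proof.
move=> m; have [s [m1 m2]] :
    exists s, mulR D (runit D a) b s /\ mulR D a s x.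
  by apply/mulRA; exists a; split=> //; exact: mul_runit.
by rewrite (lunit_uniq (runit_unit a) m1).
Qed.

Lemma one_uniq i : unitR D i -> counitR D i -> i = oneR D.
Proof.
move=> ui vi; have [s [_ m]] : exists s, counitR D s /\ mulR D i (oneR D) s.
  by apply/counitR_mul; split=> //; exact: one_counit.
exact: unit_disj ui (one_unit D) m.
Qed.

(** Multiplicativity of the counit forces the left unit of f to have
    non-zero counit as well, and 1 is the only such unit. *)
Lemma lunit_counit f : counitR D f -> lunit D f = oneR D.
Proof.
move=> vf; apply: one_uniq; first exact: lunit_unit.
suff [] : counitR D (lunit D f) /\ counitR D f by [].
by apply/counitR_mul; exists f; split=> //; exact: mul_lunit.
Qed.

End RightUnits.

Lemma one_dual (I : finType) (D : relHopf I) : oneR (dualR D) = oneR D.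
Proof.
by apply: one_uniq; [exact: (one_counit (dualR D)) | exact: (one_unit (dualR D))].
Qed.

Lemma one_opp (I : finType) (D : relHopf I) : oneR (oppR D) = oneR D.
Proof.
by apply: one_uniq; [exact: (one_unit (oppR D)) | exact: (one_counit (oppR D))].
Qed.

(** * Elements of non-zero counit are invertible *)
Section Grouplikes.
Variables (I : finType) (D : relHopf I).
Implicit Types a b e f g i j k p q x y : I.
Local Notation M := (mulR D).
Local Notation W := (comulR D).
Local Notation "1" := (oneR D).

Lemma runit_counit f : counitR D f -> runit D f = 1.
Proof. by move=> vf; rewrite -one_opp; exact: (@lunit_counit _ (oppR D)). Qed.

(* gf = 1 in the sense that the product set of g and f is {1} *)
(** The antipode axiom at f, read at 1, yields p ⊗ q in the coproduct of f
    and g in S(p) with 1 in g q.  Then q has non-zero counit, which leaves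
    only the term f ⊗ f. *)
Lemma counit_linv f : counitR D f ->
  exists g, [/\ counitR D g, antiR D f g, M g f 1 & forall s, M g f s -> s = 1].
Proof.
move=> vf.
have [p [q [g [w a m]]]] : exists p q p', [/\ W p q f, antiR D p p' & M p' q 1].
  by apply/antiRl; split=> //; exact: one_unit.
have [vg vq] : counitR D g /\ counitR D q.
  by apply/counitR_mul; exists 1; split=> //; exact: one_counit.
have pf : p = f by exact: (@unit_mulr _ (dualR D) _ _ _ vq w).
rewrite {p}pf in w a.
have qf : f = q := esym (@unit_mull _ (dualR D) _ _ _ vf w).
rewrite -{q vq}qf in w m.
exists g; split=> // s ms.
have [_ us] : counitR D f /\ unitR D s by apply/antiRl; exists f, f, g.
by rewrite -(lunit_id us) (lunit_mul ms) lunit_counit.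
Qed.

End Grouplikes.

Section Inverses.
Variables (I : finType) (D : relHopf I).
Implicit Types a b e f g i j k p q x y : I.
Local Notation M := (mulR D).
Local Notation W := (comulR D).
Local Notation "1" := (oneR D).

(** Inverses in the sense of groupoids, stated for a multivalued product:
    each product set is exactly one unit. *)
Definition inverse p q :=
  [/\ M p q (lunit D p), forall s, M p q s -> s = lunit D p,
      M q p (runit D p) & forall s, M q p s -> s = runit D p].

Lemma inverse_lunit p q : inverse p q -> lunit D q = runit D p.
Proof. by case=> m _ _ _; rewrite (mul_composable m). Qed.

Lemma inverse_runit p q : inverse p q -> runit D q = lunit D p.
Proof. by case=> _ _ m _; rewrite (mul_composable m). Qed.

Lemma inverse_sym p q : inverse p q -> inverse q p.
Proof.
by move=> pq; rewrite /inverse (inverse_lunit pq) (inverse_runit pq); case: pq.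
Qed.

Lemma inverse_mul_ex p q b : inverse p q -> runit D p = lunit D b ->
  exists x, M p b x.
Proof.
move=> [_ _ m _] rp; rewrite rp in m.
have [x [mx _]] : exists x, M p b x /\ M q x b.
  by apply/mulRA; exists (lunit D b); split=> //; exact: mul_lunit.
by exists x.
Qed.

(** Some product of q and x exists because p q is a unit, and all of them lie
    in q p b, which is b. *)
Lemma inverse_mulK p q b x : inverse p q -> M p b x -> M q x b.
Proof.
move=> pq m; have [m1 s1 _ s2] := pq.
have lx := lunit_mul m.
have [z [mz1 mz2]] : exists z, M q x z /\ M p z x.
  by apply/mulRA; exists (lunit D p); split=> //; rewrite -lx; exact: mul_lunit.
have [s [ms1 ms2]] : exists s, M q p s /\ M s b z by apply/mulRA; exists x.
rewrite (s2 _ ms1) in ms2.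
by rewrite (unit_mull (runit_unit D p) ms2).
Qed.

Lemma inverse_mul_fun p q b x y : inverse p q -> M p b x -> M p b y -> x = y.
Proof.
move=> pq mx my; have [m1 s1 m2 s2] := pq.
have [s [ms1 ms2]] : exists s, M p q s /\ M s y x.
  by apply/mulRA; exists b; split=> //; exact: inverse_mulK pq my.
by rewrite (s1 _ ms1) in ms2; rewrite (unit_mull (lunit_unit D p) ms2).
Qed.

Lemma inverse_mulI p q b c x : inverse p q -> M p b x -> M p c x -> b = c.
Proof.
move=> pq /(inverse_mulK pq) mb /(inverse_mulK pq) mc.
exact: inverse_mul_fun (inverse_sym pq) mb mc.
Qed.

Lemma counit_inv f : counitR D f ->
  exists g, [/\ counitR D g, antiR D f g & inverse f g].
Proof.
move=> vf; have [g [vg ag mg sg]] := counit_linv vf.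
have [h [vh ah mh sh]] := @counit_linv _ (oppR D) _ vf.
rewrite one_opp /= in mh sh ah.
suff gh : g = h.
  rewrite -gh in mh sh; exists g; split=> //.
  by split; rewrite ?(runit_counit vf) ?(lunit_counit vf).
have mg1 : M g 1 g by rewrite -(runit_counit vg); exact: mul_runit.
have [s [ms1 ms2]] : exists s, M g f s /\ M s h g.
  by apply/mulRA; exists 1.
rewrite (sg _ ms1) in ms2.
by rewrite -(unit_mull (one_unit D) ms2).
Qed.

(** Let f be the right counit of b and g the inverse of f.  The product b g
    is not empty because b g f contains b.  But b ⊗ f occurs in the coproduct
    of b and g in S(f), so by the antipode axiom b g may be non-empty only if
    b has non-zero counit. *)
Lemma runit1_counit b : runit D b = 1 -> counitR D b.
Proof.
move=> rb; have vf := @runit_unit _ (dualR D) b.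
have wf := @mul_runit _ (dualR D) b.
set f := runit (dualR D) b in vf wf; rewrite /= in vf wf.
have [g [vg ag [_ _ mgf _]]] := counit_inv vf.
rewrite runit_counit // in mgf.
have [s [ms _]] : exists s, M b g s /\ M s f b.
  by apply/mulRA; exists 1; split=> //; rewrite -rb; exact: mul_runit.
by have [] : counitR D b /\ unitR D s by apply/antiRr; exists b, f, g.
Qed.

(** The left counit is a grading of the product: compare the terms f ⊗ x with
    f of non-zero counit on both sides of the bialgebra axiom. *)
Lemma lcounit_mul a b x : M a b x -> M (lcounit D a) (lcounit D b) (lcounit D x).
Proof.
move=> m; have [p [q [r [t [wa wb mk ml]]]]] : exists p q r t,
    [/\ W p q a, W r t b, M p r (lcounit D x) & M q t x].
  by apply/bialgR; exists x; split=> //; exact: (@mul_lunit _ (dualR D)).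
have [vp vr] : counitR D p /\ counitR D r.
  apply/counitR_mul; exists (lcounit D x); split=> //.
  exact: (@lunit_unit _ (dualR D)).
have cE c e z : counitR D e -> W e z c -> lcounit D c = e.
  move=> ve w; rewrite -(@unit_mull _ (dualR D) _ _ _ ve w).
  exact: (@lunit_uniq _ (dualR D) _ _ _ ve w).
by rewrite (cE _ _ _ vp wa) (cE _ _ _ vr wb).
Qed.

End Inverses.

Section Grading.
Variables (I : finType) (D : relHopf I).
Implicit Types b : I.
Lemma lcounit1_unit b : lcounit D b = oneR D -> unitR D b.
Proof.
move=> h; apply: (@runit1_counit _ (oppR (dualR D))).
by rewrite one_opp one_dual.
Qed.
Lemma lcounit_counit b : counitR D (lcounit D b).
Proof. exact: (lunit_unit (dualR D)). Qed.
Lemma lcounit_comul (a b x : I) : comulR D a b x -> lcounit D x = lcounit D a.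
Proof. exact: (@lunit_mul _ (dualR D)). Qed.
Lemma lcounit_id (f : I) : counitR D f -> lcounit D f = f.
Proof. exact: (@lunit_id _ (dualR D)). Qed.
Lemma lcounit_unit (e : I) : unitR D e -> lcounit D e = oneR D.
Proof. by move=> ue; rewrite -one_dual; exact: (@lunit_counit _ (dualR D)). Qed.
End Grading.

(** * Coordinates and groupoid inverses *)
Section Coordinates.
Variables (I : finType) (D : relHopf I).
Implicit Types a b e f g i j k p q x y : I.
Local Notation M := (mulR D).
Local Notation W := (comulR D).
Local Notation "1" := (oneR D).

(** The antipode axiom at f, read at the unit i, gives p ⊗ q0 in the
    coproduct of f and q in S(q0) with i in p q.  The grading makes the left
    counits of p and q inverse to each other, so that all products p q and
    q p have left counit 1.  They are therefore units. *)
Lemma coord_ex i f : unitR D i -> counitR D f ->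
  exists p q, [/\ lunit D p = i, lcounit D p = f & inverse D p q].
Proof.
move=> ui vf.
have [p [q0 [q [w _ m]]]] : exists p q q', [/\ W p q f, antiR D q q' & M p q' i].
  by apply/antiRr.
have lp : lunit D p = i by rewrite -(lunit_mul m) lunit_id.
have rq : runit D q = i by rewrite -(runit_mul m) runit_id.
have cp : lcounit D p = f by rewrite -(lcounit_comul w) lcounit_id.
have mf := lcounit_mul m; rewrite cp (lcounit_unit ui) in mf.
have [g [vg _ fg]] := counit_inv vf.
have gq : lcounit D q = g.
  have [mfg _ _ _] := fg; rewrite lunit_counit // in mfg.
  exact: inverse_mulI fg mf mfg.
rewrite gq in mf.
have mgf1 s : M g f s -> s = 1.
  by have [_ _ _ sg] := fg; move=> /sg; rewrite runit_counit.
have unit_of s : lcounit D s = 1 -> lunit D s = s.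
  by move=> /lcounit1_unit; exact: lunit_id.
have [spq sqp] : (forall s, M p q s -> s = i) /\ (forall s, M q p s -> s = runit D p).
  split=> s ms; have := lcounit_mul ms; rewrite cp gq.
    move=> /(inverse_mul_fun fg) /(_ mf) /unit_of <-.
    by rewrite (lunit_mul ms).
  by move=> /mgf1/unit_of <-; rewrite (lunit_mul ms) (mul_composable m).
exists p, q; split=> //; split; rewrite ?lp //.
have [s [ms _]] : exists s, M q p s /\ M p s p.
  by apply/mulRA; exists i; split=> //; rewrite -{1}lp; exact: mul_lunit.
by rewrite -(sqp _ ms).
Qed.

(** If q is an inverse of p, and a has the coordinates of p, then q a is a
    unit for the same reason as q p, and multiplying back by p gives a = p. *)
Lemma coord_inj b c : lunit D b = lunit D c -> lcounit D b = lcounit D c -> b = c.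
Proof.
suff key p q a : inverse D p q -> lunit D p = lunit D a ->
    lcounit D p = lcounit D a -> p = a.
  have [p [q [lp cp pq]]] := coord_ex (lunit_unit D b) (lcounit_counit D b).
  move=> lbc cbc; rewrite -(key _ _ _ pq lp cp).
  by apply: (key _ _ _ pq); rewrite ?lp ?cp.
move=> pq la ca; have [_ spq mqp sqp] := pq.
have qp := inverse_sym pq.
have [s ms] : exists s, M q a s.
  by apply: inverse_mul_ex qp _; rewrite (inverse_runit pq).
have cs : lcounit D s = 1.
  have := lcounit_mul mqp; rewrite (lcounit_unit (runit_unit D p)).
  rewrite ca => m1; have [g [_ _ gi]] := counit_inv (lcounit_counit D q).
  exact: inverse_mul_fun gi (lcounit_mul ms) m1.
have sr : s = runit D p.
  rewrite -(lunit_id (lcounit1_unit cs)) (lunit_mul ms).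
  exact: inverse_lunit pq.
rewrite sr in ms; have := inverse_mulK qp ms => mp.
exact: inverse_mul_fun pq (mul_runit D p) mp.
Qed.

Lemma ex_inverse b : exists q, inverse D b q.
Proof.
have [p [q [lp cp pq]]] := coord_ex (lunit_unit D b) (lcounit_counit D b).
by exists q; rewrite -(coord_inj lp cp).
Qed.

Lemma ex_mul a b : runit D a = lunit D b -> exists x, M a b x.
Proof. by have [q aq] := ex_inverse a; exact: inverse_mul_ex aq. Qed.

Lemma mulR_fun a b x y : M a b x -> M a b y -> x = y.
Proof. by have [q aq] := ex_inverse a; exact: inverse_mul_fun aq. Qed.

Lemma mulR_linj a b c x : M a b x -> M a c x -> b = c.
Proof. by have [q aq] := ex_inverse a; exact: inverse_mulI aq. Qed.

Lemma inverse_lcounit p q f : inverse D p q -> inverse D (lcounit D p) f ->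
  lcounit D q = f.
Proof.
move=> [m _ _ _] [mf _ _ _]; have := lcounit_mul m.
rewrite (lcounit_unit (lunit_unit D p)) => m1.
rewrite (lunit_counit (lcounit_counit D p)) in mf; exact: mulR_linj m1 mf.
Qed.

Lemma inverse_fun p q q' : inverse D p q -> inverse D p q' -> q = q'.
Proof. by move=> [m _ _ _] [m' _ _ _]; exact: mulR_linj m m'. Qed.

(** Inversion exchanges left and right units but keeps the left counit, up to
    its inverse.  This carries the previous coordinates over to the pair of
    right unit and left counit. *)
Lemma rcoord_ex i f : unitR D i -> counitR D f ->
  exists b, runit D b = i /\ lcounit D b = f.
Proof.
move=> ui vf; have [g [vg _ fg]] := counit_inv vf.
have [b [q [lb cb bq]]] := coord_ex ui vg.
exists q; rewrite (inverse_runit bq); split=> //.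
by apply: inverse_lcounit bq _; rewrite cb; exact: inverse_sym.
Qed.

Lemma rcoord_inj b c : runit D b = runit D c -> lcounit D b = lcounit D c -> b = c.
Proof.
move=> rbc cbc; have [p bp] := ex_inverse b; have [q cq] := ex_inverse c.
suff pq : p = q.
  by rewrite pq in bp; exact: inverse_fun (inverse_sym bp) (inverse_sym cq).
apply: coord_inj; first by rewrite (inverse_lunit bp) (inverse_lunit cq).
have [g [_ _ gi]] := counit_inv (lcounit_counit D b).
rewrite (inverse_lcounit bp gi); rewrite cbc in gi.
by rewrite (inverse_lcounit cq gi).
Qed.

End Coordinates.

(** * Translations and the group law *)
Section Action.
Variables (I : finType) (D : relHopf I).
Implicit Types a b e f g i j k p q x y w z : I.
Local Notation M := (mulR D).
Local Notation W := (comulR D).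
Local Notation "1" := (oneR D).

Definition composite a b := odflt a [pick x | M a b x].

(** The defaults of odflt in composite and corner are never reached on
    composable pairs; they avoid oneR, whose value depends on a proof, so that
    lact stays convertible under the symmetries of D. *)
Definition corner f i := odflt i [pick w | (lcounit D w == f) && (runit D w == i)].

(** Left translation by an element f of the subgroup G_-: the product w b with
    the only w of left counit f for which this product exists.  In the same
    way lact (dualR D) is left translation by G_+, and the variants with oppR
    are right translations. *)
Definition lact f b := composite (corner f (lunit D b)) b.

Lemma lactE w b y : M w b y -> lact (lcounit D w) b = y.
Proof.
move=> m; rewrite /lact; have -> : corner (lcounit D w) (lunit D b) = w.
  rewrite /corner; case: pickP => [v /andP[/eqP cv /eqP rv] | /(_ w)] /=.
    by apply: (@rcoord_inj _ D); rewrite // rv (mul_composable m).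
  by rewrite (mul_composable m) !eqxx.
rewrite /composite; case: pickP => [z mz | /(_ y)] /=; first exact: mulR_fun mz m.
by rewrite m.
Qed.

Lemma lactP f b : counitR D f ->
  exists w, [/\ lcounit D w = f, runit D w = lunit D b & M w b (lact f b)].
Proof.
move=> vf; have [w [rw cw]] := rcoord_ex (lunit_unit D b) vf.
have [y my] := ex_mul rw; exists w; split=> //.
by rewrite -cw (lactE my).
Qed.

Lemma lact_lcounit f b : counitR D f -> M f (lcounit D b) (lcounit D (lact f b)).
Proof. by move=> /(lactP b)[w [<- _ m]]; exact: lcounit_mul. Qed.

Lemma lact_runit f b : counitR D f -> runit D (lact f b) = runit D b.
Proof. by move=> /(lactP b)[w [_ _ m]]; exact: runit_mul m. Qed.

Lemma lact_inj f b c : counitR D f -> lact f b = lact f c -> b = c.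
Proof.
move=> vf e; apply: (@rcoord_inj _ D).
  by rewrite -(lact_runit b vf) e lact_runit.
apply: mulR_linj (lact_lcounit b vf) _; rewrite e; exact: lact_lcounit.
Qed.

Lemma lact_coord c : lact (lcounit D c) (runit D c) = c.
Proof. exact/lactE/mul_runit. Qed.

Lemma lact1 b : lact 1 b = b.
Proof.
rewrite -(lcounit_unit (lunit_unit D b)); exact/lactE/mul_lunit.
Qed.

Lemma lact_one f : counitR D f -> lact f 1 = f.
Proof. by move=> vf; rewrite -{1}(lcounit_id vf) -(runit_counit vf) lact_coord. Qed.

End Action.

Section Commute.
Variables (I : finType) (D : relHopf I).
Implicit Types a b e f g i j k p q x y w z : I.
Local Notation M := (mulR D).
Local Notation W := (comulR D).

Lemma lact_ract f g b : counitR D f -> counitR D g ->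
  lact D f (lact (oppR D) g b) = lact (oppR D) g (lact D f b).
Proof.
move=> vf vg; have [w [<- rw mw]] := lactP b vf.
have [v [<- rv mv]] := @lactP _ (oppR D) g b vg; rewrite /= in rv mv.
set y := lact (oppR D) _ b in mv *; set x := lact D _ b in mw *.
have [z mz] : exists z, M w y z.
  by apply: ex_mul; rewrite rw (lunit_mul mv).
have [s [ms1 ms2]] : exists s, M w b s /\ M s v z.
  by apply/mulRA; exists y.
rewrite (mulR_fun ms1 mw) in ms2.
by rewrite (lactE mz) (@lactE _ (oppR D) v x z ms2).
Qed.

(** Interchange law: for b, v, w1, w2 placed in a square,
    computing the products w1 b and w2 v first and their coproduct afterwards
    agrees with the opposite order.  This is the bialgebra axiom. *)
Lemma lact_coact f e b : counitR D f -> unitR D e ->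
  lact D f (lact (oppR (dualR D)) e b) = lact (oppR (dualR D)) e (lact D f b).
Proof.
move=> vf ue; have [v [rv cv mv]] := @lactP _ (oppR (dualR D)) e b ue.
rewrite -[LHS]/(runit D v) in rv.
rewrite -[LHS]/(lcounit D v) -[RHS]/(rcounit D b) /= in cv mv.
set z := lact (oppR (dualR D)) _ b in mv *.
have [w1 [c1 r1 m1]] := lactP b vf; set x := lact D f b in m1 *.
(* w1 is the translating element for b; w2 is the corner that completes the
   square, composable with v under mulR and with w1 under comulR. *)
have [w2 [r2 c2]] := rcoord_ex (lunit_unit D v) (lunit_unit (oppR (dualR D)) w1).
have [w mw] : exists w, W w1 w2 w by apply: (@ex_mul _ (dualR D)).
have [q mq] := ex_mul r2.
have [s [ms ws]] : exists s, M w z s /\ W x q s.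
  by apply/bialgR; exists w1, w2, b, v; split.
rewrite -c1 -(lcounit_comul mw) (lactE ms).
have <- := @lactE _ (oppR (dualR D)) q x s ws.
by rewrite -[lcounit _ q]/(runit D q) (runit_mul mq) rv.
Qed.

End Commute.

Section GroupLaw.
Variables (I : finType) (D : relHopf I).
Implicit Types a b c e f g i j k p q x y w z : I.
Local Notation M := (mulR D).
Local Notation W := (comulR D).
Local Notation "1" := (oneR D).

Let unit_l b : unitR D (lunit D b) := lunit_unit D b.
Let counit_l b : counitR D (lcounit D b) := lcounit_counit D b.
Let counit_r b : counitR D (rcounit D b) := @runit_unit _ (dualR D) b.

(** In a factorized group, a = a_+ a_- acts by left translation as a_- followed
    by a_+. *)
Definition mulG a b := lact (dualR D) (lunit D a) (lact D (rcounit D a) b).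

Definition rmulG a b :=
  lact (oppR D) (rcounit D b) (lact (oppR (dualR D)) (lunit D b) a).

Lemma rcounit_counit f : counitR D f -> rcounit D f = f.
Proof. exact: (@runit_id _ (dualR D)). Qed.

Lemma rcounit_unit e : unitR D e -> rcounit D e = 1.
Proof. by move=> ue; rewrite -one_dual; exact: (@runit_counit _ (dualR D)). Qed.

Lemma mulG1 a : mulG a 1 = a.
Proof.
rewrite /mulG lact_one //; exact: (@lact_coord _ (dualR D)).
Qed.

Lemma rmul1G b : rmulG 1 b = b.
Proof.
rewrite /rmulG; have -> : lact (oppR (dualR D)) (lunit D b) 1 = lunit D b.
  rewrite -one_dual -one_opp; apply: (@lact_one _ (oppR (dualR D))).
  exact: lunit_unit.
exact: (@lact_coord _ (oppR D)).
Qed.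

(** Every left translation commutes with every right one; the four cases are
    lact_ract and lact_coact and their duals. *)
Lemma mulG_rmulG a b c : mulG a (rmulG b c) = rmulG (mulG a b) c.
Proof.
rewrite /mulG /rmulG lact_ract // lact_coact //.
rewrite -(@lact_ract _ (dualR D) _ _ _ (unit_l a) (unit_l c)); apply: esym.
exact: (@lact_coact _ (oppR D) _ _ _ (counit_r c) (unit_l a)).
Qed.

(** Both sides are translations of 1, which can be performed in either
    order.  Associativity follows at once. *)
Lemma mulGE a b : mulG a b = rmulG a b.
Proof. by rewrite -{1}(rmul1G b) mulG_rmulG mulG1. Qed.

Lemma mulGA : associative mulG.
Proof. by move=> a b c; rewrite (mulGE b c) mulG_rmulG -mulGE. Qed.

Lemma mul1G : left_id 1 mulG.
Proof. by move=> b; rewrite mulGE rmul1G. Qed.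

Lemma mulG_inj a : injective (mulG a).
Proof.
move=> b c /(@lact_inj _ (dualR D) _ _ _ (unit_l a)).
exact: (@lact_inj _ D _ _ _ (counit_r a)).
Qed.

Definition invG a := finv (mulG a) 1.

Lemma mulGV a : mulG a (invG a) = 1.
Proof. exact: (f_finv (@mulG_inj a)). Qed.

(** Right inverses exist since I is finite and left translations are
    injective; in a monoid in which all right inverses exist they are also
    left inverses. *)
Lemma mulVG : left_inverse 1 invG mulG.
Proof.
move=> a; rewrite -[LHS]mulG1 -{1}(mulGV (invG a)) -mulGA.
by rewrite (mulGA a) mulGV mul1G mulGV.
Qed.

Lemma mulG_unit s b : unitR D s -> mulG s b = lact (dualR D) s b.
Proof. by move=> us; rewrite /mulG rcounit_unit // lact1 lunit_id. Qed.

Lemma mulG_counit x b : counitR D x -> mulG x b = lact D x b.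
Proof.
move=> vx; rewrite /mulG lunit_counit // rcounit_counit //.
by rewrite -{1}one_dual lact1.
Qed.

Lemma mulG_lunit_rcounit g : mulG (lunit D g) (rcounit D g) = g.
Proof. by rewrite mulG_unit //; exact: (@lact_coord _ (dualR D)). Qed.

Lemma rcounit1_unit b : rcounit D b = 1 -> unitR D b.
Proof. by rewrite -one_dual; exact: (@runit1_counit _ (dualR D)). Qed.

Lemma lcounit_runit_mulG x s : counitR D x -> unitR D s ->
  lcounit D (mulG x s) = x /\ runit D (mulG x s) = s.
Proof.
move=> vx us; rewrite mulG_counit // lact_runit // runit_id //; split=> //.
have := lact_lcounit s vx; rewrite lcounit_unit // => m.
by rewrite -(unit_mulr (one_unit D) m).
Qed.

End GroupLaw.

Section FactorizedGroup.
Variables (I : finType) (D : relHopf I).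
Implicit Types a b c e f g i j k p q x y w z : I.
Local Notation M := (mulR D).
Local Notation W := (comulR D).
Local Notation "1" := (oneR D).

Lemma lunit_rcounit_mulG x s : unitR D s -> counitR D x ->
  lunit D (mulG D s x) = s /\ rcounit D (mulG D s x) = x.
Proof.
move=> us vx; have := @lcounit_runit_mulG _ (dualR D) _ _ us vx.
by rewrite (@mulG_counit _ (dualR D)) // mulG_unit.
Qed.

(** A copy of I which remembers D, to carry the group structure. *)
Definition relgroup : Type := let _ := D in I.

HB.instance Definition _ := Finite.copy relgroup I.
HB.instance Definition _ := Finite_isGroup.Build relgroup
  (@mulGA _ D) (@mul1G _ D) (@mulVG _ D).

Definition relplus : {set relgroup} := [set b : relgroup | unitR D b].
Definition relminus : {set relgroup} := [set b : relgroup | counitR D b].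

Lemma relplus_group : group_set relplus.
Proof.
apply/group_setP; split=> [|a b]; first by rewrite inE one_unit.
rewrite !inE => ua ub; apply: rcounit1_unit.
rewrite -[(a * b)%g]/(mulG D a b) mulG_unit //.
rewrite -[LHS]/(runit (dualR D) _) (@lact_runit _ (dualR D)) //.
exact: rcounit_unit.
Qed.
Canonical relplus_groupType := Group relplus_group.

Lemma relminus_group : group_set relminus.
Proof.
apply/group_setP; split=> [|a b]; first by rewrite inE one_counit.
rewrite !inE => va vb; apply: runit1_counit.
by rewrite -[(a * b)%g]/(mulG D a b) mulG_counit // lact_runit // runit_counit.
Qed.
Canonical relminus_groupType := Group relminus_group.

Lemma relgroup_factorization (g : relgroup) : exists! p : relgroup * relgroup,
  [/\ p.1 \in relplus_groupType, p.2 \in relminus_groupType & g = (p.1 * p.2)%g].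
Proof.
exists (lunit D g, rcounit D g); split=> [|[s x] /=].
  rewrite !inE lunit_unit; split=> //; first exact: (@runit_unit _ (dualR D)).
  by rewrite -[RHS]/(mulG D _ _) mulG_lunit_rcounit.
rewrite !inE => -[us vx ->]; rewrite -[(s * x)%g]/(mulG D s x).
by have [-> ->] := lunit_rcounit_mulG us vx.
Qed.

Definition relfactored := FactoredGroup relgroup_factorization.

Lemma rel_plus (g : relfactored) : plus g = lunit D g.
Proof.
have := plusP g; have := minusP g; rewrite !inE => vm up.
by rewrite -{2}(plus_minus g); have [] := lunit_rcounit_mulG up vm.
Qed.

Lemma rel_minus (g : relfactored) : minus g = rcounit D g.
Proof.
have := plusP g; have := minusP g; rewrite !inE => vm up.
by rewrite -{2}(plus_minus g); have [] := lunit_rcounit_mulG up vm.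
Qed.

Lemma rel_bplus (g : relfactored) : bplus g = runit D g.
Proof.
have := bplusP g; have := bminusP g; rewrite !inE => vm up.
by rewrite -{2}(bminus_bplus g); have [] := lcounit_runit_mulG vm up.
Qed.

Lemma rel_bminus (g : relfactored) : bminus g = lcounit D g.
Proof.
have := bplusP g; have := bminusP g; rewrite !inE => vm up.
by rewrite -{2}(bminus_bplus g); have [] := lcounit_runit_mulG vm up.
Qed.

End FactorizedGroup.

(** D is the support of the structure constants of H(G; G+, G-), transported
    along sigma. *)
Definition represents (I : finType) (D : relHopf I) (G : factoredGroup)
    (sigma : I -> G) : Prop :=
  [/\ bijective sigma,
   forall a b x, mulR D a b x = (bplus (sigma a) == plus (sigma b)) &&
     (sigma x == sigma a * minus (sigma b))%g,
   forall a b x, comulR D a b x = (minus (sigma a) == bminus (sigma b)) &&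
     (sigma x == plus (sigma a) * sigma b)%g,
   forall a, unitR D a = (sigma a \in Gplus G) &
   forall a, counitR D a = (sigma a \in Gminus G)].

Lemma relfactored_mul (I : finType) (D : relHopf I) (a b x : relfactored D) :
  mulR D a b x = (bplus a == plus b) && (x == a * minus b)%g.
Proof.
rewrite rel_bplus rel_plus rel_minus.
have key y : mulR D a b y -> y = (a * (rcounit D b : relfactored D))%g.
  move=> m; rewrite -[(a * _)%g]/(mulG D a (rcounit D b)) mulGE /rmulG.
  have vb : counitR D (rcounit D b) := @runit_unit _ (dualR D) b.
  rewrite lunit_counit // rcounit_counit //.
  have -> : lact (oppR (dualR D)) (oneR D) a = a.
    by rewrite -one_dual -one_opp; exact: lact1.
  exact/esym/(@lactE _ (oppR D) b a y m).
apply/idP/andP => [m | [/eqP r /eqP ->]].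
  by rewrite -(key _ m) (mul_composable m).
by have [y m] := @ex_mul I D a b r; rewrite -(key _ m).
Qed.

Lemma relfactored_comul (I : finType) (D : relHopf I) (a b x : relfactored D) :
  comulR D a b x = (minus a == bminus b) && (x == plus a * b)%g.
Proof.
rewrite rel_minus rel_plus rel_bminus.
have key y : comulR D a b y -> y = ((lunit D a : relfactored D) * b)%g.
  move=> m; rewrite -[(_ * b)%g]/(mulG D (lunit D a) b) mulG_unit ?lunit_unit //.
  exact/esym/(@lactE _ (dualR D) a b y m).
apply/idP/andP => [m | [/eqP r /eqP ->]].
  split; last by rewrite -(key _ m).
  by have /= := @mul_composable _ (dualR D) a b x m; move=> r; apply/eqP.
have [y /= m] := @ex_mul I (dualR D) a b r; by rewrite -(key _ m).
Qed.

Lemma relfactored_represents (I : finType) (D : relHopf I) :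
  represents D (id : I -> relfactored D).
Proof.
split=> [|a b x|a b x|a|a]; first by exists id.
- exact: relfactored_mul.
- exact: relfactored_comul.
- by rewrite inE.
- by rewrite inE.
Qed.

(** * The relations determine the factorized group *)
Section Uniqueness.
Variables (I : finType) (D : relHopf I) (G G' : factoredGroup).
Variables (sigma : I -> G) (sigma' : I -> G') (inv : G -> I).
Hypotheses (rG : represents D sigma) (rG' : represents D sigma').
Hypotheses (sigmaK : cancel inv sigma).

Let tau (g : G) : G' := sigma' (inv g).

Let tau_mul (g h x : G) :
  ((bplus g == plus h) && (x == g * minus h)%g) =
  (bplus (tau g) == plus (tau h)) && (tau x == tau g * minus (tau h))%g.
Proof.
have [_ mE _ _ _] := rG; have [_ mE' _ _ _] := rG'.
by rewrite -mE' mE !sigmaK.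
Qed.

Let tau_comul (g h x : G) :
  ((minus g == bminus h) && (x == plus g * h)%g) =
  (minus (tau g) == bminus (tau h)) && (tau x == plus (tau g) * tau h)%g.
Proof.
have [_ _ wE _ _] := rG; have [_ _ wE' _ _] := rG'.
by rewrite -wE' wE !sigmaK.
Qed.

Let tau_plus_mem g : (tau g \in Gplus G') = (g \in Gplus G).
Proof.
have [_ _ _ uE _] := rG; have [_ _ _ uE' _] := rG'.
by rewrite -uE' uE sigmaK.
Qed.

Let tau_minus_mem g : (tau g \in Gminus G') = (g \in Gminus G).
Proof.
have [_ _ _ _ vE] := rG; have [_ _ _ _ vE'] := rG'.
by rewrite -vE' vE sigmaK.
Qed.

Let tau_plus g : tau (plus g) = plus (tau g).
Proof.
have := tau_mul (plus g) g g; rewrite bplus_id ?plusP // plus_minus !eqxx.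
by case/esym/andP => /eqP <- _; rewrite bplus_id // tau_plus_mem plusP.
Qed.

Let tau_bplus g : tau (bplus g) = bplus (tau g).
Proof.
have := tau_mul g (bplus g) g; rewrite plus_id ?bplusP // minus1 ?bplusP //.
rewrite mulg1 !eqxx; case/esym/andP => /eqP -> _.
by rewrite plus_id // tau_plus_mem bplusP.
Qed.

Let tau_minus g : tau (minus g) = minus (tau g).
Proof.
have := tau_comul g (minus g) g; rewrite bminus_id ?minusP // plus_minus !eqxx.
by case/esym/andP => /eqP -> _; rewrite bminus_id // tau_minus_mem minusP.
Qed.

Let tau_bminus g : tau (bminus g) = bminus (tau g).
Proof.
have := tau_comul (bminus g) g g; rewrite minus_id ?bminusP // plus1 ?bminusP //.
rewrite mul1g !eqxx; case/esym/andP => /eqP <- _.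
by rewrite minus_id // tau_minus_mem bminusP.
Qed.

(** Given s in G+ and k, the element s * bminus k is composable with k for
   comulR, and its plus part is s; so this relation sees the product s * k. *)
Let tauMl s k : s \in Gplus G -> tau (s * k)%g = (tau s * tau k)%g.
Proof.
move=> sp; have := tau_comul (s * bminus k)%g k (s * k)%g.
rewrite minusMl // minus_id ?bminusP // plusMr ?bminusP // plus_id // !eqxx.
case/esym/andP => _ /eqP ->; rewrite -tau_plus plusMr ?bminusP //.
by rewrite plus_id.
Qed.

Let tauMr g x : x \in Gminus G -> tau (g * x)%g = (tau g * tau x)%g.
Proof.
move=> xm; have := tau_mul g (bplus g * x)%g (g * x)%g.
rewrite plusMr // plus_id ?bplusP // minusMl ?bplusP // minus_id // !eqxx.
case/esym/andP => _ /eqP ->; rewrite -tau_minus minusMl ?bplusP //.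
by rewrite minus_id.
Qed.

(** Write g h as g_+ (g_- h_+) h_-.  The outer factors come off by tauMl and
   tauMr; the middle product k is handled by its other factorization
   k = bminus k * bplus k, with which tau is compatible as well. *)
Let tauM : {in [set: G] &, {morph tau : g h / (g * h)%g}}.
Proof.
move=> g h _ _; rewrite -{1}(plus_minus g) -{1}(plus_minus h) mulgA.
rewrite tauMr ?minusP // -mulgA tauMl ?plusP //.
set k := (minus g * plus h)%g; rewrite -[tau k]bminus_bplus.
rewrite -tau_bminus -tau_bplus /k bminusMr ?plusP // bminus_id ?minusP //.
rewrite bplusMl ?minusP // bplus_id ?plusP // tau_plus tau_minus mulgA.
by rewrite plus_minus -mulgA tau_plus tau_minus plus_minus.
Qed.

Lemma represents_uniq_aux : factored_iso G G'.
Proof.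
have [[sigma1 sK1 sK2] _ _ _ _] := rG; have [[sigma2 sK'1 sK'2] _ _ _ _] := rG'.
have invE : inv =1 sigma1 by move=> g; rewrite -[RHS](congr1 sigma1 (sigmaK g)) sK1.
have tauK : cancel (sigma \o sigma2) tau.
  by move=> g /=; rewrite /tau invE sK1 sK'2.
have tau_inj : injective tau.
  by move=> g h /(can_inj sK'1) /(can_inj sigmaK).
exists (Morphism tauM); split.
- apply/isomP; split; first by apply/injmP => g h _ _; exact: tau_inj.
  apply/setP => g; rewrite morphimEdom [RHS]inE; apply/imsetP.
  by exists (sigma (sigma2 g)); rewrite ?inE //= -[RHS]/(tau _) -[LHS]tauK.
- apply/setP => g; rewrite morphimEsub ?subsetT //; apply/imsetP/idP => [[h hp ->] | gp].
    by rewrite tau_plus_mem.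
  exists (sigma (sigma2 g)); rewrite -?tau_plus_mem; first by rewrite [tau _]tauK.
  by rewrite -[LHS]tauK.
apply/setP => g; rewrite morphimEsub ?subsetT //; apply/imsetP/idP => [[h hp ->] | gp].
  by rewrite tau_minus_mem.
exists (sigma (sigma2 g)); rewrite -?tau_minus_mem; first by rewrite [tau _]tauK.
by rewrite -[LHS]tauK.
Qed.

End Uniqueness.

Lemma represents_uniq (I : finType) (D : relHopf I) (G G' : factoredGroup)
    (sigma : I -> G) (sigma' : I -> G') :
  represents D sigma -> represents D sigma' -> factored_iso G G'.
Proof.
move=> rG rG'; have [[inv _ invK] _ _ _ _] := rG.
exact: represents_uniq_aux rG rG' invK.
Qed.

(** * Trivializing positive cocycles *)
Section GeometricMean.
Variables (K : numClosedFieldType) (T : finType).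
Implicit Types (A : {set T}) (F : T -> K).

Definition gmean A F : K := #|A|.-root (\prod_(x in A) F x).

Lemma gmean_gt0 A F : A != set0 -> (forall x, x \in A -> 0 < F x) ->
  0 < gmean A F.
Proof.
by move=> A0 Fp; rewrite rootC_gt0 ?card_gt0 //; apply: prodr_gt0.
Qed.

Lemma gmeanM A F F' : (forall x, x \in A -> 0 < F x) ->
  gmean A (fun x => F x * F' x) = gmean A F * gmean A F'.
Proof.
move=> Fp; rewrite /gmean big_split rootCMl //.
by apply: prodr_ge0 => x xA; apply/ltW/Fp.
Qed.

Lemma gmean_const A a : A != set0 -> 0 < a -> gmean A (fun=> a) = a.
Proof.
move=> A0 a0; rewrite /gmean prodr_const rootCX ?card_gt0 ?ltW // rootCK //.
by rewrite card_gt0.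
Qed.

Lemma eq_gmean A F F' : (forall x, x \in A -> F x = F' x) -> gmean A F = gmean A F'.
Proof. by move=> e; congr (_.-root _); apply: eq_bigr. Qed.

Lemma gmean_reindex A F (h : T -> T) : {in A &, injective h} ->
  (forall x, x \in A -> h x \in A) -> gmean A (F \o h) = gmean A F.
Proof.
move=> hI hA; congr (_.-root _).
have {2}<- : h @: A = A.
  apply/eqP; rewrite eqEcard card_in_imset // leqnn andbT.
  by apply/subsetP => _ /imsetP[x xA ->]; exact: hA.
by rewrite big_imset.
Qed.

(** The averaging step: a relation a * F x = F1 x * F2 (h x) between families
    indexed by A passes to the geometric means, where h disappears. *)
Lemma gmean_coboundary A (h : T -> T) a F F1 F2 :
    A != set0 -> 0 < a -> (forall x, x \in A -> 0 < F1 x) ->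
    {in A &, injective h} -> (forall x, x \in A -> h x \in A) ->
    (forall x, x \in A -> a * F x = F1 x * F2 (h x)) ->
  a * gmean A F = gmean A F1 * gmean A F2.
Proof.
move=> A0 a0 F1p hI hA e; rewrite -{1}(gmean_const A0 a0) -[LHS]gmeanM //.
transitivity (gmean A (fun x => F1 x * F2 (h x))); first exact: eq_gmean e.
by rewrite gmeanM // -(gmean_reindex F2 hI hA).
Qed.

End GeometricMean.

Lemma coboundary_div (K : fieldType) (x a b z a' b' z' : K) :
    z != 0 -> z' != 0 -> a' != 0 -> b' != 0 ->
  x * a * b / z * z' = a' * b' -> x * (a / a') * (b / b') = z / z'.
Proof.
move=> z0 z0' a0 b0 e; apply: (mulIf (mulf_neq0 a0 b0)); rewrite -[in RHS]e.
by field; rewrite z0 z0' a0 b0.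
Qed.

(** Here m and w are the structure constants of product and coproduct on the
    pairs where they do not vanish.  Coassociativity is a cocycle identity for
    w just as associativity is for m. *)
Section Weights.
Variables (K : numClosedFieldType) (G : factoredGroup) (m w : G -> G -> K).
Implicit Types a b c g h i j p q r t : G.
Hypothesis m_gt0 : forall g h, bplus g = plus h -> 0 < m g h.
Hypothesis w_gt0 : forall g h, minus g = bminus h -> 0 < w g h.
Hypothesis m_cocycle : forall a b c, bplus a = plus b -> bplus b = plus c ->
  m a b * m (a * minus b)%g c = m b c * m a (b * minus c)%g.
Hypothesis w_cocycle : forall a b c, minus a = bminus b -> minus b = bminus c ->
  w a b * w (plus a * b)%g c = w b c * w a (plus b * c)%g.
Hypothesis mw_compat : forall p q r t, minus p = bminus q -> minus r = bminus t ->
  bplus p = plus r -> bplus q = plus t ->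
  m (plus p * q)%g (plus r * t)%g * w (p * minus r)%g (q * minus t)%g =
  w p q * w r t * (m p r * m q t).

Let Gm0 : Gminus G != set0 :> {set G}.
Proof. by apply/set0Pn; exists 1%g; exact: group1. Qed.
Let Gp0 : Gplus G != set0 :> {set G}.
Proof. by apply/set0Pn; exists 1%g; exact: group1. Qed.

(** The elements h with plus h = bplus g, which may follow g in a product, are
   the bplus g * x with x in G-. *)
Let d1 g := gmean (Gminus G) (fun x => m g (bplus g * x)%g).

Let d1_term g x : x \in Gminus G -> 0 < m g (bplus g * x)%g.
Proof. by move=> xm; apply: m_gt0; rewrite plusMr // plus_id // bplusP. Qed.

Let d1_gt0 g : 0 < d1 g. Proof. by apply: gmean_gt0 => // x; exact: d1_term. Qed.

Let d1M a b : bplus a = plus b -> m a b * d1 (a * minus b)%g = d1 a * d1 b.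
Proof.
move=> ab; have mab := m_gt0 ab.
have bab : bplus (a * minus b)%g = bplus b.
  by rewrite -mul_bminusE // bplusMl ?bminusP.
rewrite [RHS]mulrC; apply: (gmean_coboundary (h := fun x => (minus b * x)%g)) => //.
- by move=> x; exact: d1_term.
- by move=> x y _ _ /mulgI.
- by move=> x xm; rewrite groupM ?minusP.
move=> x xm; rewrite bab m_cocycle //; last by rewrite plusMr // plus_id ?bplusP.
by rewrite minusMl ?bplusP // minus_id // ab !mulgA plus_minus.
Qed.

(** The constants of the coproduct once the basis is divided by d1. *)
Let w1 h k := w h k * d1 h * d1 k / d1 (plus h * k)%g.

Let w1_gt0 h k : minus h = bminus k -> 0 < w1 h k.
Proof. by move=> hk; rewrite /w1 divr_gt0 ?mulr_gt0 ?d1_gt0 ?w_gt0. Qed.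

Let d1_neq0 g : d1 g != 0. Proof. exact: lt0r_neq0. Qed.

Let w1_cocycle a b c : minus a = bminus b -> minus b = bminus c ->
  w1 a b * w1 (plus a * b)%g c = w1 b c * w1 a (plus b * c)%g.
Proof.
move=> ab bc; rewrite /w1 plusMl ?plusP // -(mulgA (plus a) (plus b)%g c).
set z := (plus a * (plus b * c))%g.
transitivity (w a b * w (plus a * b)%g c * (d1 a * d1 b * d1 c) / d1 z).
  by field; rewrite !d1_neq0.
by rewrite w_cocycle //; field; rewrite !d1_neq0.
Qed.

(** As the product has become strict, the bialgebra axiom says that w1 is
   multiplicative. *)
Let w1M p q r t : minus p = bminus q -> minus r = bminus t ->
  bplus p = plus r -> bplus q = plus t ->
  w1 (p * minus r)%g (q * minus t)%g = w1 p q * w1 r t.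
Proof.
move=> pq rt pr qt.
set i := (plus p * q)%g; set j := (plus r * t)%g.
have bpij : bplus i = plus j.
  rewrite /i /j plusMl ?plusP // -pr -qt.
  have -> : (plus p * q = p * bplus q)%g.
    by rewrite -{2}(plus_minus p) pq -[RHS]mulgA bminus_bplus.
  by rewrite bplusMr ?bplusP.
have zE : (plus (p * minus r) * (q * minus t) = i * minus j)%g.
  by rewrite plusMr ?minusP // /i /j minusMl ?plusP // mulgA.
rewrite /w1 zE -/i -/j.
have := mw_compat pq rt pr qt; rewrite -/i -/j.
set k := (p * _)%g; set l := (q * _)%g => e.
have e1 : d1 k = d1 p * d1 r / m p r.
  by rewrite -(d1M pr) mulrC mulKf // lt0r_neq0 ?m_gt0.
have e2 : d1 l = d1 q * d1 t / m q t.
  by rewrite -(d1M qt) mulrC mulKf // lt0r_neq0 ?m_gt0.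
have e3 : d1 (i * minus j)%g = d1 i * d1 j / m i j.
  by rewrite -(d1M bpij) mulrC mulKf // lt0r_neq0 ?m_gt0.
rewrite e1 e2 e3.
have n1 : m p r != 0 by rewrite lt0r_neq0 ?m_gt0.
have n2 : m q t != 0 by rewrite lt0r_neq0 ?m_gt0.
have n3 : m i j != 0 by rewrite lt0r_neq0 ?m_gt0.
transitivity (m i j * w k l * (d1 p * d1 r * d1 q * d1 t) /
    (m p r * m q t * d1 i * d1 j)).
  by field; rewrite n1 n2 n3 !d1_neq0.
by rewrite e; field; rewrite n1 n2 !d1_neq0.
Qed.

(** The elements k with bminus k = minus g are the minus g * s with s in G+. *)
Let d2 g := gmean (Gplus G) (fun s => w1 g (minus g * s)%g).

Let d2_term g s : s \in Gplus G -> 0 < w1 g (minus g * s)%g.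
Proof. by move=> sp; apply: w1_gt0; rewrite bminusMr // bminus_id // minusP. Qed.

Let d2_gt0 g : 0 < d2 g. Proof. by apply: gmean_gt0 => // x; exact: d2_term. Qed.

Let d2W a b : minus a = bminus b -> w1 a b * d2 (plus a * b)%g = d2 a * d2 b.
Proof.
move=> ab; have wab := w1_gt0 ab.
rewrite [RHS]mulrC; apply: (gmean_coboundary (h := fun s => (bplus b * s)%g)) => //.
- by move=> s; exact: d2_term.
- by move=> x y _ _ /mulgI.
- by move=> s sp; rewrite groupM ?bplusP.
move=> s sp; rewrite minusMl ?plusP // w1_cocycle //; last first.
  by rewrite bminusMr // bminus_id ?minusP.
by rewrite !mulgA plus_minus ab bminus_bplus.
Qed.

(** Multiplicativity of d2 means that dividing by it does not spoil the product.
   A right partner c of a * minus b factors as the product of a partner of a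
   and a partner of b, and w1M splits the corresponding factor of d2. *)
Let d2M a b : bplus a = plus b -> d2 (a * minus b)%g = d2 a * d2 b.
Proof.
move=> ab; rewrite {1}/d2 minusMr ?minusP //.
rewrite (@eq_gmean _ _ _ _ (fun s => w1 a (minus a * plus (minus b * s))%g *
    w1 b (minus b * s)%g)); last first.
  move=> s sp; have -> : (minus a * minus b * s =
      minus a * plus (minus b * s) * minus (minus b * s))%g.
    by rewrite -[RHS]mulgA plus_minus mulgA.
  apply: w1M => //.
  - by rewrite bminusMr ?plusP // bminus_id // minusP.
  - by rewrite bminusMr // bminus_id // minusP.
  by rewrite bplusMl ?minusP // bplus_id ?plusP.
rewrite gmeanM => [|s sp]; last by apply: d2_term; exact: plusP.
congr (_ * _).
rewrite -[RHS](@gmean_reindex _ _ _ _ (fun s => plus (minus b * s))%g) //.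
  move=> x y xp yp /= e.
  have yE : y = (x * ((minus (minus b * x))^-1 * minus (minus b * y)))%g.
    apply: (mulgI (minus b)); rewrite (mulgA (minus b) x).
    set u := (minus b * x)%g in e *; set v := (minus b * y)%g in e *.
    by rewrite -{1}(plus_minus u) mulgA mulgK e plus_minus.
  by rewrite -(plus_id xp) -(plus_id yp) yE plusMr // groupM ?groupV ?minusP.
by move=> s sp; exact: plusP.
Qed.

Lemma weights_exist : exists d : G -> K, [/\ forall g, 0 < d g,
    forall g h, bplus g = plus h -> m g h * d (g * minus h)%g = d g * d h &
    forall g h, minus g = bminus h -> w g h * d g * d h = d (plus g * h)%g].
Proof.
have d2_neq0 g : d2 g != 0 by exact: lt0r_neq0.
exists (fun g => d1 g / d2 g); split=> [g | g h gh | g h gh].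
- by rewrite divr_gt0.
- by rewrite mulrA d1M // d2M // mulf_div.
exact: (coboundary_div (d1_neq0 _) (d2_neq0 _) (d2_neq0 g) (d2_neq0 h) (d2W gh)).
Qed.

End Weights.

(** * Structure constants and their supports *)

(** The coordinates of a Hopf algebra in a positive basis indexed by I;
    pcomul i j k is the coefficient of i ⊗ j in the coproduct of k, in line
    with comulR. *)
Record posHopf (K : numFieldType) (I : finType) := PosHopf {
  pmul : I -> I -> I -> K;
  pcomul : I -> I -> I -> K;
  punit : I -> K;
  pcounit : I -> K;
  panti : I -> I -> K;
  pmul_ge0 : forall i j k, 0 <= pmul i j k;
  pcomul_ge0 : forall i j k, 0 <= pcomul i j k;
  punit_ge0 : forall i, 0 <= punit i;
  pcounit_ge0 : forall i, 0 <= pcounit i;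
  panti_ge0 : forall i j, 0 <= panti i j;
  pmulA : forall i j k t,
    \sum_s pmul i j s * pmul s k t = \sum_s pmul j k s * pmul i s t;
  pmul1l : forall j k, \sum_i punit i * pmul i j k = (j == k)%:R;
  pmul1r : forall j k, \sum_i punit i * pmul j i k = (j == k)%:R;
  pcomulA : forall i j k t,
    \sum_s pcomul i j s * pcomul s k t = \sum_s pcomul j k s * pcomul i s t;
  pcomul1l : forall j k, \sum_i pcounit i * pcomul i j k = (j == k)%:R;
  pcomul1r : forall j k, \sum_i pcounit i * pcomul j i k = (j == k)%:R;
  pbialg : forall i j k l, \sum_s pmul i j s * pcomul k l s =
    \sum_p \sum_q \sum_r \sum_t
      pcomul p q i * pcomul r t j * (pmul p r k * pmul q t l);
  pcomul_unit : forall k l, \sum_s punit s * pcomul k l s = punit k * punit l;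
  pcounit_mul : forall i j, \sum_s pcounit s * pmul i j s = pcounit i * pcounit j;
  pcounit_unit : \sum_s punit s * pcounit s = 1;
  pantil : forall i r, \sum_p \sum_q \sum_p'
    pcomul p q i * panti p p' * pmul p' q r = pcounit i * punit r;
  pantir : forall i r, \sum_p \sum_q \sum_q'
    pcomul p q i * panti q q' * pmul p q' r = pcounit i * punit r
}.

(** The absence of cancellation, through which identities between structure
    constants descend to their supports. *)
Lemma psum_neq0 (K : numFieldType) (I : finType) (F : I -> K) :
  (forall i, 0 <= F i) -> (\sum_i F i != 0) <-> (exists i, F i != 0).
Proof.
move=> F0; rewrite psumr_neq0 //; split=> [/hasP[i _ /= /lt0r_neq0] | [i Fi]].
  by exists i.
by apply/hasP; exists i; rewrite ?mem_index_enum //= lt0r Fi F0.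
Qed.

Lemma sum_single (V : nmodType) (I : finType) (i : I) (F : I -> V) :
  (forall j, F j != 0 -> j = i) -> \sum_j F j = F i.
Proof.
move=> Fi; rewrite (bigD1 i) //= big1 ?addr0 // => j ji.
by apply/eqP; apply: contraNT ji => /Fi ->.
Qed.

Section Support.
Variables (K : numFieldType) (I : finType) (P : posHopf K I).
Local Notation m := (pmul P).
Local Notation c := (pcomul P).

Let m0 := pmul_ge0 P.
Let c0 := pcomul_ge0 P.
Let u0 := punit_ge0 P.
Let e0 := pcounit_ge0 P.
Let s0 := panti_ge0 P.

Let mulf_neq0E (x y : K) : (x * y != 0) = (x != 0) && (y != 0).
Proof. by rewrite mulf_eq0 negb_or. Qed.

Let psum2 (F F' : I -> K) : (forall i, 0 <= F i) -> (forall i, 0 <= F' i) ->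
  (exists i, F i != 0 /\ F' i != 0) <-> (\sum_i F i * F' i != 0).
Proof.
move=> F0 F0'; rewrite psum_neq0 => [|i]; last exact: mulr_ge0.
split=> -[k]; first by move=> [a b]; exists k; rewrite mulf_neq0E a.
by rewrite mulf_neq0E => /andP[]; exists k.
Qed.

Let delta_neq0 (j k : I) : ((j == k)%:R != 0 :> K) <-> j = k.
Proof. by rewrite pnatr_eq0 eqb0 negbK; split=> [/eqP | /eqP]. Qed.

Fact supp_mulA i j k t :
  (exists s, m i j s != 0 /\ m s k t != 0) <-> (exists s, m j k s != 0 /\ m i s t != 0).
Proof. by rewrite !psum2 // pmulA. Qed.

Fact supp_mul1l j k : (exists i, punit P i != 0 /\ m i j k != 0) <-> j = k.
Proof. by rewrite psum2 // pmul1l. Qed.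

Fact supp_mul1r j k : (exists i, punit P i != 0 /\ m j i k != 0) <-> j = k.
Proof. by rewrite psum2 // pmul1r. Qed.

Fact supp_comulA i j k t :
  (exists s, c i j s != 0 /\ c s k t != 0) <-> (exists s, c j k s != 0 /\ c i s t != 0).
Proof. by rewrite !psum2 // pcomulA. Qed.

Fact supp_comul1l j k : (exists i, pcounit P i != 0 /\ c i j k != 0) <-> j = k.
Proof. by rewrite psum2 // pcomul1l. Qed.

Fact supp_comul1r j k : (exists i, pcounit P i != 0 /\ c j i k != 0) <-> j = k.
Proof. by rewrite psum2 // pcomul1r. Qed.

Fact supp_bialg i j k l : (exists s, m i j s != 0 /\ c k l s != 0) <->
  (exists p q r t, [/\ c p q i != 0, c r t j != 0, m p r k != 0 & m q t l != 0]).
Proof.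
have F0 p q r t : 0 <= c p q i * c r t j * (m p r k * m q t l).
  by rewrite !mulr_ge0.
rewrite psum2 // pbialg psum_neq0 => [|p]; last first.
  by do 3![apply: sumr_ge0 => ? _].
split=> [[p] | [p [q [r [t [a b d e]]]]]].
  rewrite psum_neq0 => [[q]|q]; last by do 2![apply: sumr_ge0 => ? _].
  rewrite psum_neq0 => [[r]|r]; last by apply: sumr_ge0.
  rewrite psum_neq0 // => -[t]; rewrite !mulf_neq0E.
  by move=> /andP[/andP[a b] /andP[d e]]; exists p, q, r, t.
exists p; rewrite psum_neq0 => [|?]; last by do 2![apply: sumr_ge0 => ? _].
exists q; rewrite psum_neq0 => [|?]; last by apply: sumr_ge0.
exists r; rewrite psum_neq0 //.
by exists t; rewrite !mulf_neq0E a b d e.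
Qed.

Fact supp_comul_unit k l :
  (exists s, punit P s != 0 /\ c k l s != 0) <-> punit P k != 0 /\ punit P l != 0.
Proof. by rewrite psum2 // pcomul_unit mulf_neq0E; split=> /andP. Qed.

Fact supp_counit_mul i j :
  (exists s, pcounit P s != 0 /\ m i j s != 0) <->
  pcounit P i != 0 /\ pcounit P j != 0.
Proof. by rewrite psum2 // pcounit_mul mulf_neq0E; split=> /andP. Qed.

Fact supp_counit_unit : exists s, punit P s != 0 /\ pcounit P s != 0.
Proof. by rewrite psum2 // pcounit_unit oner_eq0. Qed.

Let psum3 (F : I -> I -> I -> K) : (forall i j k, 0 <= F i j k) ->
  (\sum_i \sum_j \sum_k F i j k != 0) <-> (exists i j k, F i j k != 0).
Proof.
move=> F0; rewrite psum_neq0 => [|p]; last by do 2![apply: sumr_ge0 => ? _].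
split=> [[p] | [p [q [r n]]]].
  rewrite psum_neq0 => [[q]|q]; last by apply: sumr_ge0.
  by rewrite psum_neq0 // => -[r n]; exists p, q, r.
exists p; rewrite psum_neq0 => [|?]; last by apply: sumr_ge0.
by exists q; rewrite psum_neq0 //; exists r.
Qed.

Fact supp_antil i r :
  (exists p q p', [/\ c p q i != 0, panti P p p' != 0 & m p' q r != 0]) <->
  pcounit P i != 0 /\ punit P r != 0.
Proof.
rewrite (rwP andP) -mulf_neq0E -pantil psum3 => [|*]; last by rewrite !mulr_ge0.
split=> -[p [q [p' n]]]; exists p, q, p'; move: n.
  by rewrite !mulf_neq0E => -[-> -> ->].
by rewrite !mulf_neq0E => /andP[/andP[]].
Qed.

Fact supp_antir i r :
  (exists p q q', [/\ c p q i != 0, panti P q q' != 0 & m p q' r != 0]) <->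
  pcounit P i != 0 /\ punit P r != 0.
Proof.
rewrite (rwP andP) -mulf_neq0E -pantir psum3 => [|*]; last by rewrite !mulr_ge0.
split=> -[p [q [p' n]]]; exists p, q, p'; move: n.
  by rewrite !mulf_neq0E => -[-> -> ->].
by rewrite !mulf_neq0E => /andP[/andP[]].
Qed.

Definition pos_support : relHopf I := {|
  mulR i j k := m i j k != 0; comulR i j k := c i j k != 0;
  unitR i := punit P i != 0; counitR i := pcounit P i != 0;
  antiR i j := panti P i j != 0;
  mulRA := supp_mulA; unitRl := supp_mul1l; unitRr := supp_mul1r;
  comulRA := supp_comulA; counitRl := supp_comul1l; counitRr := supp_comul1r;
  bialgR := supp_bialg; comulR_unit := supp_comul_unit;
  counitR_mul := supp_counit_mul; counitR_unit := supp_counit_unit;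
  antiRl := supp_antil; antiRr := supp_antir |}.

End Support.

(** * Rescaling to the structure constants of H(G; G+, G-) *)
Section Rescaling.
Variables (K : numClosedFieldType) (I : finType) (P : posHopf K I).
Local Notation m := (pmul P).
Local Notation c := (pcomul P).
Local Notation D := (pos_support P).
Local Notation M := (mulR D).
Local Notation W := (comulR D).

(** Since the products are single-valued, each sum in the axioms has a single
    non-zero term; the axioms become the cocycle identities. *)
Lemma pmulA_single i j k s s' t : M i j s -> M s k t -> M j k s' -> M i s' t ->
  m i j s * m s k t = m j k s' * m i s' t.
Proof.
move=> m1 m2 m3 m4; have := pmulA P i j k t.
rewrite (@sum_single _ _ s) => [|x]; last first.
  by rewrite mulf_eq0 negb_or => /andP[mx _]; exact: (mulR_fun (D := D) mx m1).
rewrite (@sum_single _ _ s') // => x.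
by rewrite mulf_eq0 negb_or => /andP[mx _]; exact: (mulR_fun (D := D) mx m3).
Qed.

Lemma pcomulA_single i j k s s' t : W i j s -> W s k t -> W j k s' -> W i s' t ->
  c i j s * c s k t = c j k s' * c i s' t.
Proof.
move=> m1 m2 m3 m4; have := pcomulA P i j k t.
rewrite (@sum_single _ _ s) => [|x]; last first.
  by rewrite mulf_eq0 negb_or => /andP[mx _]; exact: (mulR_fun (D := dualR D) mx m1).
rewrite (@sum_single _ _ s') // => x.
by rewrite mulf_eq0 negb_or => /andP[mx _]; exact: (mulR_fun (D := dualR D) mx m3).
Qed.

Lemma pbialg_single p q r t i j k l s : W p q i -> W r t j -> M p r k -> M q t l ->
  M i j s -> m i j s * c k l s = c p q i * c r t j * (m p r k * m q t l).
Proof.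
move=> wi wj mk ml ms; have := pbialg P i j k l.
rewrite (@sum_single _ _ s) => [->|x]; last first.
  by rewrite mulf_eq0 negb_or => /andP[mx _]; exact: (mulR_fun (D := D) mx ms).
(* p has the left unit of k and the left counit of i, which determine it; the
   groupoid laws then give q, r and t in turn. *)
have uniq p' q' r' t' : c p' q' i * c r' t' j * (m p' r' k * m q' t' l) != 0 ->
    [/\ p' = p, q' = q, r' = r & t' = t].
  rewrite !mulf_eq0 !negb_or => /andP[/andP[wi' wj'] /andP[mk' ml']].
  have pp : p' = p.
    apply: (@coord_inj _ D).
      by rewrite -(lunit_mul (D := D) mk') (lunit_mul (D := D) mk).
    by rewrite -(lcounit_comul (D := D) wi') (lcounit_comul (D := D) wi).
  rewrite pp in wi' mk'.
  have qq : q' = q by exact: (mulR_linj (D := dualR D) wi' wi).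
  rewrite qq in ml'; split=> //.
    exact: (mulR_linj (D := D) mk' mk).
  exact: (mulR_linj (D := D) ml' ml).
rewrite (@sum_single _ _ p) => [|p' /eqP n]; last first.
  apply/eqP; apply: contraPT (erefl p) => np; case: n.
  rewrite big1 // => q' _; rewrite big1 // => r' _; rewrite big1 // => t' _.
  by apply/eqP; apply: contraNT np => /uniq[->].
rewrite (@sum_single _ _ q) => [|q' /eqP n]; last first.
  apply/eqP; apply: contraPT (erefl p) => np; case: n.
  rewrite big1 // => r' _; rewrite big1 // => t' _.
  by apply/eqP; apply: contraNT np => /uniq[_ ->].
rewrite (@sum_single _ _ r) => [|r' /eqP n]; last first.
  apply/eqP; apply: contraPT (erefl p) => np; case: n.
  rewrite big1 // => t' _.
  by apply/eqP; apply: contraNT np => /uniq[_ _ ->].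
by rewrite (@sum_single _ _ t) // => t' /uniq[].
Qed.

Variables (G : factoredGroup) (sigma : I -> G) (inv : G -> I).
Hypotheses (rG : represents D sigma) (sigmaK : cancel sigma inv)
  (invK : cancel inv sigma).

Let mg (g h : G) : K := m (inv g) (inv h) (inv (g * minus h)%g).
Let wg (g h : G) : K := c (inv g) (inv h) (inv (plus g * h)%g).

Let mulP (g h : G) : bplus g = plus h -> M (inv g) (inv h) (inv (g * minus h)%g).
Proof. by have [_ mE _ _ _] := rG; move=> gh; rewrite mE !invK gh !eqxx. Qed.

Let comulP (g h : G) : minus g = bminus h -> W (inv g) (inv h) (inv (plus g * h)%g).
Proof. by have [_ _ wE _ _] := rG; move=> gh; rewrite wE !invK gh !eqxx. Qed.

Let mg_gt0 g h : bplus g = plus h -> 0 < mg g h.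
Proof. by move=> /mulP gh; rewrite lt0r pmul_ge0 andbT. Qed.

Let wg_gt0 g h : minus g = bminus h -> 0 < wg g h.
Proof. by move=> /comulP gh; rewrite lt0r pcomul_ge0 andbT. Qed.

Let mg_cocycle a b e : bplus a = plus b -> bplus b = plus e ->
  mg a b * mg (a * minus b)%g e = mg b e * mg a (b * minus e)%g.
Proof.
move=> ab be; have bab : bplus (a * minus b)%g = bplus b.
  by rewrite -mul_bminusE // bplusMl ?bminusP.
have E : (a * minus b * minus e = a * minus (b * minus e))%g.
  by rewrite minusMr ?minusP // mulgA.
rewrite /mg -E; apply: pmulA_single; rewrite ?mulP ?bab //.
by rewrite E mulP // plusMr ?minusP.
Qed.

Let wg_cocycle a b e : minus a = bminus b -> minus b = bminus e ->
  wg a b * wg (plus a * b)%g e = wg b e * wg a (plus b * e)%g.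
Proof.
move=> ab be; have mab : minus (plus a * b)%g = minus b.
  by rewrite minusMl ?plusP.
have E : (plus (plus a * b) * e = plus a * (plus b * e))%g.
  by rewrite plusMl ?plusP // -[LHS]mulgA.
rewrite /wg E; apply: pcomulA_single; rewrite ?comulP ?mab //.
  by rewrite -E comulP ?mab.
have -> : (plus b * e = b * bplus e)%g.
  by rewrite -{2}(plus_minus b) be -[RHS]mulgA bminus_bplus.
by rewrite bminusMr ?bplusP.
Qed.

Let mwg_compat p q r t : minus p = bminus q -> minus r = bminus t ->
  bplus p = plus r -> bplus q = plus t ->
  mg (plus p * q)%g (plus r * t)%g * wg (p * minus r)%g (q * minus t)%g =
  wg p q * wg r t * (mg p r * mg q t).
Proof.
move=> pq rt pr qt; set i := (plus p * q)%g; set j := (plus r * t)%g.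
have bpij : bplus i = plus j.
  rewrite /i /j plusMl ?plusP // -pr -qt.
  have -> : (plus p * q = p * bplus q)%g.
    by rewrite -{2}(plus_minus p) pq -[RHS]mulgA bminus_bplus.
  by rewrite bplusMr ?bplusP.
have zE : (plus (p * minus r) * (q * minus t) = i * minus j)%g.
  by rewrite plusMr ?minusP // /i /j minusMl ?plusP // mulgA.
by rewrite /wg /mg zE; apply: pbialg_single; rewrite ?comulP ?mulP.
Qed.

(** Product and coproduct are settled by weights_exist.  A unit i is
    idempotent, so its weight is pmul P i i i, and the unit axiom at i makes
    this inverse to the coefficient of i in 1; dually for counits. *)
Lemma represents_rescaling : exists d : I -> K,
  [/\ forall i, 0 < d i,
    forall i j k, m i j k * d k = d i * d j * (M i j k)%:R,
    forall i j k, c i j k * d i * d j = d k * (W i j k)%:R,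
    forall i, punit P i * d i = (unitR D i)%:R &
    forall i, pcounit P i = d i * (counitR D i)%:R].
Proof.
have [_ MG WG _ _] := rG.
have [dg [dg_gt0 dM dW]] :=
  weights_exist mg_gt0 wg_gt0 mg_cocycle wg_cocycle mwg_compat.
pose d i := dg (sigma i); have d_gt0 i : 0 < d i by exact: dg_gt0.
have d0 i : d i != 0 := lt0r_neq0 (d_gt0 i).
have mE i j k : m i j k * d k = d i * d j * (M i j k)%:R.
  have [mn | /= mz] := boolP (M i j k); last first.
    by rewrite negbK in mz; rewrite (eqP mz) mul0r mulr0.
  have := mn; rewrite MG => /andP[/eqP ij /eqP kE].
  by rewrite mulr1 /d -dM // -kE /mg -kE !sigmaK.
have cE i j k : c i j k * d i * d j = d k * (W i j k)%:R.
  have [wn | /= wz] := boolP (W i j k); last first.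
    by rewrite negbK in wz; rewrite (eqP wz) !mul0r mulr0.
  have := wn; rewrite WG => /andP[/eqP ij /eqP kE].
  by rewrite mulr1 /d kE -dW // /wg -kE !sigmaK.
exists d; split=> // i.
  have [ui | /= uz] := boolP (unitR D i); last first.
    by rewrite negbK in uz; rewrite (eqP uz) mul0r.
  have mii : M i i i := unit_mul_id ui.
  have := mE i i i; rewrite mii mulr1 => /(mulIf (d0 i)) <-.
  have := pmul1l P i i; rewrite eqxx (@sum_single _ _ i) // => j.
  rewrite mulf_eq0 negb_or => /andP[uj mj].
  by rewrite (unit_disj (D := D) uj ui mj).
have [vi | /= vz] := boolP (counitR D i); last first.
  by rewrite negbK in vz; rewrite (eqP vz) mulr0.
have wii : W i i i := @unit_mul_id _ (dualR D) _ vi.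
have := cE i i i; rewrite wii mulr1 => /eqP; rewrite -[X in _ == X]mul1r.
rewrite (inj_eq (mulIf (d0 i))) => /eqP wd.
have := pcomul1l P i i; rewrite eqxx (@sum_single _ _ i) => [ec|j].
  by rewrite -[LHS]mulr1 -wd mulrA ec mul1r.
rewrite mulf_eq0 negb_or => /andP[uj mj].
by rewrite (@unit_disj _ (dualR D) _ _ _ uj vi mj).
Qed.

End Rescaling.

(** * From a Hopf algebra to its structure constants *)
Section TensorFunctional.
Variables (K : fieldType).

(** Tensors are tested against pairs of functionals; this avoids identifying
    the position of an elementary tensor in a basis of the tensor product. *)
Definition tens_fun (V W : vectType K) (phi : V -> K) (psi : W -> K)
    (t : tensor V W) : K :=
  tens_lift (fun v w => phi v * psi w : K^o) t.

Lemma tens_fun_linear (V W : vectType K) (phi : V -> K) (psi : W -> K) :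
  scalar (tens_fun phi psi).
Proof. by move=> a x y; rewrite /tens_fun linearP. Qed.

HB.instance Definition _ (V W : vectType K) (phi : V -> K) (psi : W -> K) :=
  GRing.isLinear.Build K (tensor V W) K _ (tens_fun phi psi)
    (tens_fun_linear phi psi).

Lemma tens_funE (V W : vectType K) (phi : {scalar V}) (psi : {scalar W}) v w :
  tens_fun phi psi (tens v w) = phi v * psi w.
Proof.
rewrite /tens_fun tens_liftE // => [w'|v'] a x y /=.
  by rewrite linearP mulrDl scalerAl.
by rewrite linearP mulrDr scalerAr.
Qed.

Lemma tens_scalel (V W : vectType K) a (v : V) (w : W) :
  tens (a *: v) w = a *: tens v w.
Proof. by have := tens_linl w a v 0; rewrite addr0 tens0l addr0. Qed.

Lemma tens_scaler (V W : vectType K) a (v : V) (w : W) :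
  tens v (a *: w) = a *: tens v w.
Proof. by have := tens_linr v a w 0; rewrite addr0 tens0r addr0. Qed.

Lemma tens_fun_assoc (U V W : vectType K) (phi : {scalar U}) (psi : {scalar V})
    (chi : {scalar W}) (t : tensor U V) w :
  tens_fun phi (tens_fun psi chi) (tens_assoc (tens t w)) =
  tens_fun phi psi t * chi w.
Proof.
pose f t := tens_fun phi (tens_fun psi chi) (tens_assoc (tens t w)).
pose g t : K^o := tens_fun phi psi t * chi w.
have fl : linear (f : _ -> K^o).
  by move=> a x y; rewrite /f tens_linl !linearP.
have gl : linear g by move=> a x y; rewrite /g linearP mulrDl scalerAl.
pose F := HB.pack_for {linear tensor U V -> K^o} f
  (GRing.isLinear.Build K _ _ _ (f : _ -> K^o) fl).
pose G := HB.pack_for {linear tensor U V -> K^o} g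
  (GRing.isLinear.Build K _ _ _ g gl).
apply: (@tens_ext _ _ _ _ F G) => u v; rewrite /= /f /g.
by rewrite tens_assocE (tens_funE phi (tens_fun psi chi)) /= !tens_funE mulrA.
Qed.

End TensorFunctional.

Section StructureConstants.
Variables (K : fieldType) (H : hopfAlgType K) (n : nat) (B : n.-tuple H).
Hypothesis bB : basis_of {:H} B.
Implicit Types (i j k p q r s t : 'I_n).
Local Notation b i := (tnth B i).
Local Notation x_ i := (coord B i).

Definition sc_mul i j k := x_ k (b i * b j).
Definition sc_comul i j k := tens_fun (x_ i) (x_ j) (comul (b k)).
Definition sc_unit i := x_ i (1 : H).
Definition sc_counit i := counit (b i).
Definition sc_anti i j := x_ j (antipode (b i)).

Lemma basis_expand v : v = \sum_i x_ i v *: b i.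
Proof.
rewrite {1}(coord_basis bB (memvf v)); apply: eq_bigr => i _.
by rewrite (tnth_nth 0).
Qed.

Lemma basis_coord i j : x_ i (b j) = (i == j)%:R.
Proof. by rewrite (tnth_nth 0) coord_free ?(basis_free bB) // eq_sym. Qed.

Lemma mul_expand i j : b i * b j = \sum_k sc_mul i j k *: b k.
Proof. exact: basis_expand. Qed.

Lemma one_expand : 1 = \sum_i sc_unit i *: b i.
Proof. exact: basis_expand. Qed.

Lemma anti_expand i : antipode (b i) = \sum_j sc_anti i j *: b j.
Proof. exact: basis_expand. Qed.

Lemma tens_expand (t : tensor H H) :
  t = \sum_i \sum_j tens_fun (x_ i) (x_ j) t *: tens (b i) (b j).
Proof.
pose f (t : tensor H H) := \sum_i \sum_j tens_fun (x_ i) (x_ j) t *: tens (b i) (b j).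
have fl : linear f.
  move=> a x y; rewrite /f scaler_sumr -big_split; apply: eq_bigr => i _ /=.
  rewrite scaler_sumr -big_split; apply: eq_bigr => j _ /=.
  by rewrite linearP scalerDl scalerA.
pose F := HB.pack_for {linear tensor H H -> tensor H H} f
  (GRing.isLinear.Build K _ _ _ f fl).
apply: (@tens_ext _ _ _ _ idfun F) => v w /=; rewrite /f.
rewrite {1}(basis_expand v) tens_suml; apply: eq_bigr => i _.
rewrite {1}(basis_expand w) tens_sumr; apply: eq_bigr => j _.
by rewrite tens_scalel tens_scaler scalerA tens_funE.
Qed.

Lemma comul_expand k :
  comul (b k) = \sum_i \sum_j sc_comul i j k *: tens (b i) (b j).
Proof. exact: tens_expand. Qed.

Lemma comul_lin (U : lmodType K) (f : tensor H H -> U) k : linear f ->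
  f (comul (b k)) = \sum_i \sum_j sc_comul i j k *: f (tens (b i) (b j)).
Proof.
move=> fl; pose F := HB.pack_for {linear tensor H H -> U} f
  (GRing.isLinear.Build K _ _ _ f fl).
rewrite -[f]/(F : _ -> _) comul_expand linear_sum; apply: eq_bigr => i _.
by rewrite linear_sum; apply: eq_bigr => j _; rewrite linearZ.
Qed.

Lemma sum_delta (V : nzSemiRingType) (i : 'I_n) (F : 'I_n -> V) :
  \sum_j F j * (i == j)%:R = F i.
Proof.
rewrite (bigD1 i) //= eqxx mulr1 big1 ?addr0 // => j ji.
by rewrite eq_sym (negPf ji) mulr0.
Qed.

Lemma sc_mulA i j k t :
  \sum_s sc_mul i j s * sc_mul s k t = \sum_s sc_mul j k s * sc_mul i s t.
Proof.
transitivity (x_ t (b i * b j * b k)).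
  rewrite mul_expand mulr_suml linear_sum; apply: eq_bigr => s _.
  by rewrite -scalerAl linearZ.
rewrite -mulrA mul_expand mulr_sumr linear_sum; apply: eq_bigr => s _.
by rewrite -scalerAr linearZ.
Qed.

Lemma sc_mul1l j k : \sum_i sc_unit i * sc_mul i j k = (j == k)%:R.
Proof.
rewrite eq_sym -basis_coord -[b j in RHS]mul1r one_expand mulr_suml linear_sum.
by apply: eq_bigr => s _; rewrite -scalerAl linearZ.
Qed.

Lemma sc_mul1r j k : \sum_i sc_unit i * sc_mul j i k = (j == k)%:R.
Proof.
rewrite eq_sym -basis_coord -[b j in RHS]mulr1 one_expand mulr_sumr linear_sum.
by apply: eq_bigr => s _; rewrite -scalerAr linearZ.
Qed.

Lemma sc_comulA i j k t :
  \sum_s sc_comul i j s * sc_comul s k t = \sum_s sc_comul j k s * sc_comul i s t.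
Proof.
have idl : linear (@id H) by [].
have cl : linear (@comul K H) := @comul_linear K H.
pose F := tens_fun (x_ i) (tens_fun (x_ j) (x_ k)).
pose f (z : tensor H H) : K^o := F (tens_assoc (tens_map comul id z)).
pose g (z : tensor H H) : K^o := F (tens_map id comul z).
have fl : linear f by move=> a x y; rewrite /f /F !linearP.
have gl : linear g by move=> a x y; rewrite /g /F !linearP.
have : f (comul (b t)) = g (comul (b t)) by rewrite /f comulA.
rewrite !comul_lin // => e.
transitivity (\sum_p \sum_q sc_comul p q t *: f (tens (b p) (b q))).
  apply: eq_bigr => p _.
  rewrite -[LHS](sum_delta k (fun q => sc_comul i j p * sc_comul p q t)).
  apply: eq_bigr => q _; rewrite /f /F tens_mapE // tens_fun_assoc /= basis_coord.
  by rewrite -mulrA; exact: mulrCA.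
rewrite e exchange_big; apply: eq_bigr => q _ /=.
rewrite -[RHS](sum_delta i (fun p => sc_comul j k q * sc_comul p q t)).
apply: eq_bigr => p _; rewrite /g /F tens_mapE //.
rewrite (tens_funE _ (tens_fun (x_ j) (x_ k))) /= basis_coord.
by rewrite -[LHS]/(_ * _) [LHS]mulrC -mulrA mulrC.
Qed.

Lemma sc_comul1l j k : \sum_i sc_counit i * sc_comul i j k = (j == k)%:R.
Proof.
rewrite -basis_coord -[b k in RHS](comul_counitl (b k)).
rewrite comul_lin ?linear_sum => [|a x y]; last by rewrite linearP.
apply: eq_bigr => p _; rewrite linear_sum.
rewrite -[LHS](sum_delta j (fun q => sc_counit p * sc_comul p q k)).
apply: eq_bigr => q _; rewrite linearZ /= tens_liftE => [|v|v] /=; first last.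
- by move=> a x y; rewrite scalerDr !scalerA mulrC.
- by move=> a x y; rewrite linearP scalerDl scalerA.
by rewrite linearZ /= basis_coord !mulrA; ring.
Qed.

Lemma sc_comul1r j k : \sum_i sc_counit i * sc_comul j i k = (j == k)%:R.
Proof.
rewrite -basis_coord -[b k in RHS](comul_counitr (b k)).
rewrite comul_lin ?linear_sum => [|a x y]; last by rewrite linearP.
apply: esym; rewrite (eq_bigr (fun p => \sum_q x_ j (sc_comul p q k *: (sc_counit q *: b p)))).
  rewrite exchange_big; apply: eq_bigr => q _.
  rewrite -[RHS](sum_delta j (fun p => sc_counit q * sc_comul p q k)).
  apply: eq_bigr => p _; rewrite !linearZ /= basis_coord.
  by rewrite mulrCA !mulrA eq_sym.
move=> p _; rewrite linear_sum.
apply: eq_bigr => q _; rewrite tens_liftE => [|v|v] //=.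
- by move=> a x y; rewrite scalerDr !scalerA mulrC.
by move=> a x y; rewrite linearP scalerDl scalerA.
Qed.

Lemma sc_bialg i j k l : \sum_s sc_mul i j s * sc_comul k l s =
  \sum_p \sum_q \sum_r \sum_t
    sc_comul p q i * sc_comul r t j * (sc_mul p r k * sc_mul q t l).
Proof.
transitivity (tens_fun (x_ k) (x_ l) (comul (b i * b j))).
  rewrite mul_expand !linear_sum; apply: eq_bigr => s _.
  by rewrite !linearZ.
rewrite comulM.
pose f (z : tensor H H) : K^o := tens_fun (x_ k) (x_ l) (tens_mul z (comul (b j))).
rewrite -[LHS]/(f (comul (b i))) comul_lin => [|a x y]; last first.
  by rewrite /f tens_mul_linl linearP.
apply: eq_bigr => p _; apply: eq_bigr => q _; rewrite /f.
pose g (z : tensor H H) : K^o := tens_fun (x_ k) (x_ l) (tens_mul (tens (b p) (b q)) z).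
rewrite -[tens_fun _ _ _]/(g (comul (b j))) comul_lin => [|a x y]; last first.
  by rewrite /g tens_mul_linr linearP.
rewrite scaler_sumr; apply: eq_bigr => r _.
rewrite scaler_sumr; apply: eq_bigr => t _.
by rewrite /g tens_mulE tens_funE scalerA.
Qed.

Lemma sc_comul_unit k l :
  \sum_s sc_unit s * sc_comul k l s = sc_unit k * sc_unit l.
Proof.
rewrite -[RHS](tens_funE (x_ k) (x_ l)) -comul1 one_expand !linear_sum.
by apply: eq_bigr => s _; rewrite !linearZ.
Qed.

Lemma sc_counit_mul i j :
  \sum_s sc_counit s * sc_mul i j s = sc_counit i * sc_counit j.
Proof.
rewrite -counitM mul_expand linear_sum; apply: eq_bigr => s _.
by rewrite linearZ /= mulrC.
Qed.

Lemma sc_counit_unit : \sum_s sc_unit s * sc_counit s = 1.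
Proof.
transitivity (counit (1 : H)); last exact: counit1.
by rewrite one_expand linear_sum; apply: eq_bigr => s _; rewrite linearZ.
Qed.

Lemma sc_antil i r : \sum_p \sum_q \sum_p'
  sc_comul p q i * sc_anti p p' * sc_mul p' q r = sc_counit i * sc_unit r.
Proof.
transitivity (x_ r (counit (b i) *: 1)); last by rewrite linearZ.
rewrite -antipodel comul_lin ?linear_sum => [|a x y]; last by rewrite linearP.
apply: eq_bigr => p _; rewrite linear_sum; apply: eq_bigr => q _.
rewrite linearZ /= tens_liftE => [|v|v] /=; first last.
- by move=> a x y; rewrite mulrDr -scalerAr.
- by move=> a x y; rewrite linearP mulrDl -scalerAl.
have -> : antipode (b p) * b q = \sum_p' sc_anti p p' *: b p' * b q.
  by rewrite anti_expand mulr_suml.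
rewrite linear_sum mulr_sumr; apply: eq_bigr => p' _.
by rewrite -scalerAl linearZ /= mulrA.
Qed.

Lemma sc_antir i r : \sum_p \sum_q \sum_q'
  sc_comul p q i * sc_anti q q' * sc_mul p q' r = sc_counit i * sc_unit r.
Proof.
transitivity (x_ r (counit (b i) *: 1)); last by rewrite linearZ.
rewrite -antipoder comul_lin ?linear_sum => [|a x y]; last by rewrite linearP.
apply: eq_bigr => p _; rewrite linear_sum; apply: eq_bigr => q _.
rewrite linearZ /= tens_liftE => [|v|v] /=; first last.
- by move=> a x y; rewrite linearP mulrDr -scalerAr.
- by move=> a x y; rewrite mulrDl -scalerAl.
have -> : b p * antipode (b q) = \sum_q' b p * (sc_anti q q' *: b q').
  by rewrite anti_expand mulr_sumr.
rewrite linear_sum mulr_sumr; apply: eq_bigr => q' _.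
by rewrite -scalerAr linearZ /= mulrA.
Qed.

End StructureConstants.

Section PositiveConstants.
Variables (K : numFieldType) (H : hopfAlgType K) (n : nat) (B : n.-tuple H).
Hypothesis posB : positive_basis B.
Local Notation b i := (tnth B i).
Local Notation x_ i := (coord B i).

Let bB : basis_of {:H} B. Proof. by case: posB. Qed.

Lemma sc_mul_ge0 i j k : 0 <= sc_mul B i j k.
Proof. by have [_ [_ _ mB _ _]] := posB; apply: mB; exact: mem_tnth. Qed.

Lemma sc_unit_ge0 i : 0 <= sc_unit B i.
Proof. by have [_ [uB _ _ _ _]] := posB; exact: uB. Qed.

Lemma sc_counit_ge0 i : 0 <= sc_counit B i.
Proof. by have [_ [_ eB _ _ _]] := posB; apply: eB; exact: mem_tnth. Qed.

Lemma sc_anti_ge0 i j : 0 <= sc_anti B i j.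
Proof. by have [_ [_ _ _ _ sB]] := posB; apply: sB; exact: mem_tnth. Qed.

(** Positivity is given for coordinates in tens_tuple B; a product of two
    coordinate functionals takes values 0 and 1 on its entries. *)
Lemma sc_comul_ge0 i j k : 0 <= sc_comul B i j k.
Proof.
have [_ [_ _ _ cB _]] := posB.
rewrite /sc_comul (coord_basis (tens_tuple_basis bB) (memvf (comul (b k)))).
rewrite linear_sum; apply: sumr_ge0 => l _; rewrite linearZ /=.
apply: mulr_ge0; first by apply: cB; exact: mem_tnth.
have : (tens_tuple B)`_l \in tens_tuple B by rewrite mem_nth ?size_tuple.
case/allpairsP => -[v w] /= [/tnthP[p ->] /tnthP[q ->] ->].
by rewrite tens_funE /= !(basis_coord bB) -natrM ler0n.
Qed.

Definition basis_posHopf : posHopf K 'I_n := {|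
  pmul := sc_mul B; pcomul := sc_comul B; punit := sc_unit B;
  pcounit := sc_counit B; panti := sc_anti B;
  pmul_ge0 := sc_mul_ge0; pcomul_ge0 := sc_comul_ge0;
  punit_ge0 := sc_unit_ge0; pcounit_ge0 := sc_counit_ge0;
  panti_ge0 := sc_anti_ge0;
  pmulA := sc_mulA bB; pmul1l := sc_mul1l bB; pmul1r := sc_mul1r bB;
  pcomulA := sc_comulA bB; pcomul1l := sc_comul1l bB; pcomul1r := sc_comul1r bB;
  pbialg := sc_bialg bB; pcomul_unit := sc_comul_unit bB;
  pcounit_mul := sc_counit_mul bB; pcounit_unit := sc_counit_unit bB;
  pantil := sc_antil bB; pantir := sc_antir bB |}.

End PositiveConstants.

(** * Rescaled bases and the supports of structure constants *)
Section HGCoordinates.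
Variables (K : fieldType) (G : factoredGroup).

Definition hcoord (g : G) (y : hG K G) : K := y g.

Lemma hcoord_linear g : scalar (hcoord g).
Proof. by move=> a x y; rewrite /hcoord !ffunE. Qed.
HB.instance Definition _ g :=
  GRing.isLinear.Build K (hG K G) K _ (hcoord g) (hcoord_linear g).

Lemma hcoordE g h : hcoord g (hbase K h) = (g == h)%:R.
Proof. by rewrite /hcoord ffunE. Qed.

Lemma hcoord_hmul g h x : hcoord x (hbase K g * hbase K h) =
  ((bplus g == plus h) && (x == g * minus h)%g)%:R.
Proof.
by rewrite hbaseM; case: eqP => _; rewrite ?hcoordE // linear0.
Qed.

Lemma hcoord_comul g h x : tens_fun (hcoord g) (hcoord h) (comul (hbase K x)) =
  ((minus g == bminus h) && (x == plus g * h)%g)%:R.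
Proof.
rewrite -[comul _]/(hcomul (hbase K x)) /hcomul hextE linear_sum.
rewrite (@sum_single _ _ g) => [|g']; last first.
  apply: contraNeq => g'g; rewrite linear_sum big1 // => h' _.
  by rewrite /= tens_funE /= hcoordE eq_sym (negPf g'g) mul0r.
rewrite linear_sum big_mkcond (@sum_single _ _ h) => [|h']; last first.
  case: ifP => _; last by rewrite eqxx.
  apply: contraNeq => h'h.
  by rewrite /= tens_funE /= !hcoordE [h == _]eq_sym (negPf h'h) mulr0.
rewrite [bminus h == _]eq_sym [_ == x]eq_sym andbC.
by case: ifP; rewrite //= tens_funE /= !hcoordE !eqxx mulr1.
Qed.

Lemma hcoord_one g : hcoord g (1 : hG K G) = (g \in Gplus G)%:R.
Proof.
rewrite -[1]/(hone K G) /hone linear_sum big_mkcond (@sum_single _ _ g).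
  by case: ifP => _; rewrite //= hcoordE eqxx.
move=> h; case: ifP => _; last by rewrite eqxx.
by apply: contraNeq => hg; rewrite /= hcoordE [g == h]eq_sym (negPf hg).
Qed.

Lemma counit_hbase g : counit (hbase K g) = (g \in Gminus G)%:R.
Proof.
rewrite -[LHS]/(hcounit (hbase K g)) hcounitE; congr (_%:R).
congr (nat_of_bool _); apply/eqP/idP => [g1 | gm]; last exact: plus1.
by rewrite -(plus_minus g) g1 mul1g minusP.
Qed.

Lemma hcoord_ext (y y' : hG K G) : (forall g, hcoord g y = hcoord g y') -> y = y'.
Proof. by move=> e; apply/ffunP. Qed.

End HGCoordinates.

Section Represented.
Variables (K : numFieldType) (H : hopfAlgType K) (n : nat) (B : n.-tuple H).
Variables (G : factoredGroup).
Local Notation b i := (tnth B i).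
Local Notation x_ i := (coord B i).

(** Rescaling by non-zero numbers does not change supports. *)
Lemma rescales_to_represents (posB : positive_basis B) : rescales_to B G ->
  exists sigma : 'I_n -> G, represents (pos_support (basis_posHopf posB)) sigma.
Proof.
have bB : basis_of {:H} B by case: posB.
move=> [d' [d'_gt0 [f [[_ fD fe _] [sigma [sb fB]]]]]]; exists sigma.
have s_inj := bij_inj sb.
pose d i := (d' i)^-1.
have d0 i : d i != 0 by rewrite invr_eq0 lt0r_neq0.
have fb i : f (b i) = d i *: hbase K (sigma i).
  by rewrite -fB linearZ scalerA mulVf ?scale1r // lt0r_neq0.
have xf k v : hcoord (sigma k) (f v) = x_ k v * d k.
  rewrite {1}(basis_expand bB v) !linear_sum (@sum_single _ _ k) => [|l].
    by rewrite !linearZ /= fb linearZ /= hcoordE eqxx mulr1.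
  rewrite !linearZ /= fb linearZ /= hcoordE (inj_eq s_inj).
  by have [//|_] := eqVneq k l; rewrite !mulr0 eqxx.
have xfc p q k : tens_fun (hcoord (sigma p)) (hcoord (sigma q)) (comul (f (b k))) =
    sc_comul B p q k * d p * d q.
  have -> : sc_comul B p q k * d p * d q = sc_comul B p q k * (d p * d q).
    by rewrite mulrA.
  rewrite fD (comul_lin bB) ?linear_sum => [|a x y]; last by rewrite linearP.
  have E i j : tens_fun (hcoord (sigma p)) (hcoord (sigma q))
      (sc_comul B i j k *: tens_map f f (tens (b i) (b j))) =
      sc_comul B i j k * ((p == i)%:R * d p * ((q == j)%:R * d q)).
    rewrite linearZ /= tens_mapE; try exact: linearP.
    by rewrite tens_funE /= !xf !(basis_coord bB).
  rewrite (@sum_single _ _ p) => [|i]; rewrite linear_sum; last first.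
    apply: contraNeq => ip; apply/eqP/big1 => j _.
    by rewrite /= E [p == i]eq_sym (negPf ip) !mul0r mulr0.
  rewrite (@sum_single _ _ q) => [|j]; rewrite /= E.
    by rewrite !eqxx !mul1r.
  by apply: contraNeq => jq; rewrite [q == j]eq_sym (negPf jq) mul0r !mulr0.
split=> // [i j k|i j k|i|i] /=.
- have := xf k (b i * b j); rewrite rmorphM /= !fb -scalerAl -scalerAr.
  rewrite !linearZ /= hcoord_hmul => /esym e.
  have -> : (sc_mul B i j k != 0) = (sc_mul B i j k * d k != 0).
    by rewrite mulf_eq0 (negPf (d0 k)) orbF.
  rewrite e !mulf_eq0 (negPf (d0 i)) (negPf (d0 j)) /=.
  by rewrite pnatr_eq0 eqb0 negbK.
- have := xfc i j k; rewrite fb !linearZ /= hcoord_comul => /esym e.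
  have -> : (sc_comul B i j k != 0) = (sc_comul B i j k * d i * d j != 0).
    by rewrite !mulf_eq0 (negPf (d0 i)) (negPf (d0 j)) !orbF.
  rewrite e !mulf_eq0 (negPf (d0 k)) /=.
  by rewrite pnatr_eq0 eqb0 negbK.
- have := xf i 1; rewrite rmorph1 hcoord_one => /esym e.
  have -> : (sc_unit B i != 0) = (sc_unit B i * d i != 0).
    by rewrite mulf_eq0 (negPf (d0 i)) orbF.
  by rewrite e pnatr_eq0 eqb0 negbK.
rewrite /sc_counit -fe fb linearZ /= counit_hbase.
by rewrite mulf_eq0 (negPf (d0 i)) /= pnatr_eq0 eqb0 negbK.
Qed.

End Represented.

(** * The antipode *)

(** A left and a right convolution inverse of f agree, by the usual
    phi = phi * (f * psi) = (phi * f) * psi = psi. *)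
Lemma conv_uniq (K : fieldType) (A : algType K) (I : finType)
    (c : I -> I -> I -> K) (e : I -> K) (phi f psi : I -> A) :
    (forall i j k t, \sum_s c i j s * c s k t = \sum_s c j k s * c i s t) ->
    (forall j k, \sum_i e i * c i j k = (j == k)%:R) ->
    (forall j k, \sum_i e i * c j i k = (j == k)%:R) ->
    (forall i, \sum_p \sum_q c p q i *: (phi p * f q) = e i *: 1) ->
    (forall i, \sum_p \sum_q c p q i *: (f p * psi q) = e i *: 1) ->
  phi =1 psi.
Proof.
move=> cA el er phif fpsi i.
have delta (g : I -> A) : \sum_p (p == i)%:R *: g p = g i.
  rewrite (@sum_single _ _ i) => [|p]; first by rewrite eqxx scale1r.
  by have [//|_] := eqVneq p i; rewrite scale0r eqxx.
transitivity (\sum_p \sum_q \sum_r (\sum_s c p q s * c s r i) *: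
    (phi p * f q * psi r)).
  rewrite -[LHS]delta; apply: eq_bigr => p _; rewrite -er scaler_suml.
  transitivity (\sum_s \sum_q \sum_r (c q r s * c p s i) *: (phi p * f q * psi r)).
    apply: eq_bigr => s _.
    rewrite mulrC -scalerA -[phi p in LHS]mulr1 scalerAr -fpsi mulr_sumr scaler_sumr.
    apply: eq_bigr => q _; rewrite mulr_sumr scaler_sumr; apply: eq_bigr => r _.
    by rewrite -scalerAr scalerA mulrC mulrA.
  rewrite exchange_big; apply: eq_bigr => q _.
  rewrite exchange_big; apply: eq_bigr => r _.
  by rewrite cA scaler_suml.
transitivity (\sum_r \sum_s \sum_p \sum_q
    (c p q s * c s r i) *: (phi p * f q * psi r)).
  under eq_bigr => p _ do rewrite exchange_big.
  rewrite exchange_big; apply: eq_bigr => r _.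
  rewrite [RHS]exchange_big; apply: eq_bigr => p _.
  rewrite [RHS]exchange_big; apply: eq_bigr => q _.
  by rewrite scaler_suml.
rewrite -[RHS]delta; apply: eq_bigr => r _; rewrite -el scaler_suml.
apply: eq_bigr => s _.
rewrite mulrC -scalerA -[psi r in RHS]mul1r scalerAl -phif mulr_suml scaler_sumr.
apply: eq_bigr => p _; rewrite mulr_suml scaler_sumr; apply: eq_bigr => q _.
by rewrite -scalerAl scalerA mulrC.
Qed.

(** Both antipode o f and f o antipode are convolution inverses of f. *)
Lemma bialgebra_antipode (K : fieldType) (H H' : hopfAlgType K) (n : nat)
    (B : n.-tuple H) (f : {lrmorphism H -> H'}) : basis_of {:H} B ->
    (forall x, comul (f x) = tens_map f f (comul x)) ->
    (forall x, counit (f x) = counit x) ->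
  forall x, antipode (f x) = f (antipode x).
Proof.
move=> bB fD fe x.
have key : (fun i => antipode (f (tnth B i))) =1 (fun i => f (antipode (tnth B i))).
  apply: (@conv_uniq _ _ _ (sc_comul B) (sc_counit B) _ (fun i => f (tnth B i))).
  - exact: sc_comulA.
  - exact: sc_comul1l.
  - exact: sc_comul1r.
  - move=> i; rewrite /sc_counit -fe -antipodel fD.
    rewrite (@comul_lin _ _ _ _ bB _ (fun t => tens_lift _ (tens_map f f t))).
      apply: eq_bigr => p _; apply: eq_bigr => q _; congr (_ *: _).
      rewrite tens_mapE; try exact: linearP.
      rewrite tens_liftE // => [w|v] a y z; first by rewrite linearP mulrDl -scalerAl.
      by rewrite mulrDr -scalerAr.
    by move=> a y z; rewrite !linearP.
  move=> i; rewrite /sc_counit -[1](rmorph1 f) -linearZ -antipoder.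
  pose g (t : tensor H H) := f (tens_lift (fun a b : H => a * antipode b) t).
  have gl : linear g by move=> a y z; rewrite /g !linearP.
  rewrite -[RHS]/(g (comul (tnth B i))) (comul_lin bB i gl).
  apply: eq_bigr => p _; apply: eq_bigr => q _; congr (_ *: _); rewrite /g.
  rewrite tens_liftE ?rmorphM // => [w|v] a y z; first by rewrite mulrDl -scalerAl.
  by rewrite linearP mulrDr -scalerAr.
rewrite (basis_expand bB x) !linear_sum; apply: eq_bigr => i _.
by rewrite !linearZ /= key.
Qed.

(** * The isomorphism onto H(G; G+, G-) *)
Section Construction.
Variables (K : numFieldType) (H : hopfAlgType K) (n : nat) (B : n.-tuple H).
Hypothesis posB : positive_basis B.
Local Notation D := (pos_support (basis_posHopf posB)).
Variables (G : factoredGroup) (sigma : 'I_n -> G) (d : 'I_n -> K).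
Local Notation b i := (tnth B i).
Local Notation x_ i := (coord B i).
Local Notation h_ i := (hbase K (sigma i)).
Hypotheses (rG : represents D sigma) (d_gt0 : forall i, 0 < d i).
Hypothesis mulE : forall i j k,
  sc_mul B i j k * d k = d i * d j * (mulR D i j k)%:R.
Hypothesis comulE : forall i j k,
  sc_comul B i j k * d i * d j = d k * (comulR D i j k)%:R.
Hypothesis unitE : forall i, sc_unit B i * d i = (unitR D i)%:R.
Hypothesis counitE : forall i, sc_counit B i = d i * (counitR D i)%:R.

Let bB : basis_of {:H} B. Proof. by case: posB. Qed.
Let s_bij : bijective sigma. Proof. by case: rG. Qed.
Let s_inj : injective sigma. Proof. exact: bij_inj s_bij. Qed.
Let d_neq0 i : d i != 0. Proof. exact: lt0r_neq0. Qed.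

Definition to_hG (v : H) : hG K G := \sum_i x_ i v *: (d i *: h_ i).

Lemma to_hG_linear : linear to_hG.
Proof.
move=> a v w; rewrite /to_hG scaler_sumr -big_split; apply: eq_bigr => i _ /=.
by rewrite linearP scalerDl -scalerA.
Qed.

HB.instance Definition _ :=
  GRing.isLinear.Build K H (hG K G) _ to_hG to_hG_linear.

Lemma to_hG_basis i : to_hG (b i) = d i *: h_ i.
Proof.
rewrite /to_hG (@sum_single _ _ i) => [|j].
  by rewrite (basis_coord bB) eqxx scale1r.
by rewrite (basis_coord bB); have [//|_] := eqVneq j i; rewrite scale0r eqxx.
Qed.

Lemma to_hG_coord k v : hcoord (sigma k) (to_hG v) = x_ k v * d k.
Proof.
rewrite /to_hG linear_sum (@sum_single _ _ k) => [|j].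
  by rewrite !linearZ /= hcoordE eqxx mulr1.
rewrite !linearZ /= hcoordE (inj_eq s_inj).
by have [//|_] := eqVneq k j; rewrite !mulr0 eqxx.
Qed.

Lemma hG_coord_ext (y y' : hG K G) :
  (forall k, hcoord (sigma k) y = hcoord (sigma k) y') -> y = y'.
Proof.
move=> e; apply: hcoord_ext => g; have [t _ st] := s_bij.
by rewrite -(st g).
Qed.

Lemma basis_ext (U : lmodType K) (f g : H -> U) : linear f -> linear g ->
  (forall i, f (b i) = g (b i)) -> f =1 g.
Proof.
move=> fl gl e x.
pose F := HB.pack_for {linear H -> U} f (GRing.isLinear.Build K _ _ _ f fl).
pose F' := HB.pack_for {linear H -> U} g (GRing.isLinear.Build K _ _ _ g gl).
rewrite -[LHS]/(F x) -[RHS]/(F' x) (basis_expand bB x) !linear_sum.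
by apply: eq_bigr => i _; rewrite !linearZ /= e.
Qed.

Lemma to_hG_monoid : monoid_morphism to_hG.
Proof.
split.
  apply: hG_coord_ext => k; rewrite to_hG_coord hcoord_one.
  by have [_ _ _ uE _] := rG; rewrite -uE -unitE.
move=> v w; move: v; apply: basis_ext => [a v v'|a v v'|i].
- by rewrite mulrDl -scalerAl linearP.
- by rewrite linearP mulrDl -scalerAl.
move: w; apply: basis_ext => [a v v'|a v v'|j].
- by rewrite mulrDr -scalerAr linearP.
- by rewrite linearP mulrDr -scalerAr.
apply: hG_coord_ext => k; rewrite to_hG_coord !to_hG_basis.
rewrite -scalerAl -scalerAr !linearZ /= hcoord_hmul.
by have [_ mE _ _ _] := rG; rewrite -mE -[LHS]/(sc_mul B i j k * d k) mulE mulrA.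
Qed.

HB.instance Definition _ :=
  GRing.isMonoidMorphism.Build H (hG K G) to_hG to_hG_monoid.

Lemma tens_hG_ext (t t' : tensor (hG K G) (hG K G)) :
  (forall p q, tens_fun (hcoord p) (hcoord q) t = tens_fun (hcoord p) (hcoord q) t') ->
  t = t'.
Proof.
pose F (t : tensor (hG K G) (hG K G)) : tensor (hG K G) (hG K G) :=
  \sum_g \sum_h tens_fun (hcoord g) (hcoord h) t *: tens (hbase K g) (hbase K h).
have Fl : linear F.
  move=> a x y; rewrite /F scaler_sumr -big_split; apply: eq_bigr => g _ /=.
  rewrite scaler_sumr -big_split; apply: eq_bigr => h _ /=.
  by rewrite linearP scalerDl scalerA.
pose F' := HB.pack_for {linear tensor (hG K G) (hG K G) -> tensor (hG K G) (hG K G)} F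
  (GRing.isLinear.Build K _ _ _ F Fl).
have FE x : x = F x.
  apply: (@tens_ext _ _ _ _ idfun F') => v w /=; rewrite /F.
  rewrite {1}(hbase_span v) tens_suml; apply: eq_bigr => g _.
  rewrite {1}(hbase_span w) tens_sumr; apply: eq_bigr => h _.
  by rewrite tens_scalel tens_scaler scalerA tens_funE.
move=> e; rewrite (FE t) (FE t'); apply: eq_bigr => g _; apply: eq_bigr => h _.
by rewrite e.
Qed.

Lemma to_hG_comul x : comul (to_hG x) = tens_map to_hG to_hG (comul x).
Proof.
move: x; apply: basis_ext => [a v v'|a v v'|k]; rewrite ?linearP //.
have [t _ st] := s_bij.
apply: tens_hG_ext => g h; rewrite -(st g) -(st h).
move: (t g) (t h) => p q.
rewrite to_hG_basis !linearZ /= hcoord_comul.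
have [_ _ wE _ _] := rG; rewrite -wE -comulE.
pose f t : K^o := tens_fun (hcoord (sigma p)) (hcoord (sigma q)) (tens_map to_hG to_hG t).
rewrite -[RHS]/(f (comul (b k))) (comul_lin bB) => [|a x y]; last by rewrite /f !linearP.
have E i j : f (tens (b i) (b j)) = (p == i)%:R * d p * ((q == j)%:R * d q).
  rewrite /f tens_mapE; try exact: linearP.
  by rewrite tens_funE /= !to_hG_coord !(basis_coord bB).
rewrite (@sum_single _ _ p) => [|i]; last first.
  apply: contraNeq => ip; apply/eqP/big1 => j _.
  by rewrite E [p == i]eq_sym (negPf ip) !mul0r scaler0.
rewrite (@sum_single _ _ q) => [|j]; rewrite E.
  by rewrite !eqxx !mul1r -mulrA.
by apply: contraNeq => jq; rewrite [q == j]eq_sym (negPf jq) mul0r mulr0 scaler0.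
Qed.

Lemma to_hG_counit x : counit (to_hG x) = counit x.
Proof.
move: x; apply: (@basis_ext K^o) => [a v v'|a v v'|k]; rewrite ?linearP //.
rewrite to_hG_basis linearZ /= counit_hbase.
by have [_ _ _ _ vE] := rG; rewrite -vE -counitE.
Qed.

Lemma to_hG_bij : bijective to_hG.
Proof.
exists (fun y => \sum_i (hcoord (sigma i) y / d i) *: b i) => [x | y].
  rewrite [RHS](basis_expand bB); apply: eq_bigr => i _.
  by rewrite to_hG_coord mulfK.
apply: hG_coord_ext => k; rewrite to_hG_coord linear_sum (@sum_single _ _ k).
  by rewrite linearZ /= (basis_coord bB) eqxx mulr1 divfK.
move=> j; rewrite linearZ /= (basis_coord bB).
by have [//|_] := eqVneq k j; rewrite mulr0 eqxx.
Qed.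

Lemma represents_rescales_to : rescales_to B G.
Proof.
exists (fun i => (d i)^-1); split=> [i|]; first by rewrite invr_gt0.
exists (to_hG : {lrmorphism H -> hG K G}); split.
  split; [exact: to_hG_bij | exact: to_hG_comul | exact: to_hG_counit |].
  exact: (bialgebra_antipode bB to_hG_comul to_hG_counit).
exists sigma; split=> // i.
by rewrite linearZ /= to_hG_basis scalerA mulVf ?scale1r.
Qed.

End Construction.

Theorem theorem1 (R : realType) (H : hopfAlgType R[i]) (n : nat)
    (B : n.-tuple H) (posB : positive_basis B) :
  exists G : factoredGroup,
    rescales_to B G /\
    (forall G' : factoredGroup, rescales_to B G' -> factored_iso G G').
Proof.
have rG := relfactored_represents (pos_support (basis_posHopf posB)).
have [[inv sK iK] _ _ _ _] := rG.
have [d [d_gt0 mE cE uE eE]] := represents_rescaling rG sK iK.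
exists (relfactored (pos_support (basis_posHopf posB))); split.
  exact: represents_rescales_to rG d_gt0 mE cE uE eE.
move=> G' /(rescales_to_represents posB)[sigma' rG'].
exact: represents_uniq rG rG'.
Qed.
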